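(* Let $\Phi\colon\mathbb{R}^n\to\mathbb{R}$ be a lower semi-continuous function. Let $\boldsymbol{a}=(a_1,\dots,a_n)$ and $\boldsymbol{b}=(b_1,\dots,b_n)$ be two vectors in $(0,+\infty)^n$, let $\boldsymbol{v}_0\in\mathbb{R}^n$, let $P$ be an invertible real $n\times n$ matrix, and let $M=PP^T$. For $\boldsymbol{x}\in\mathbb{R}^n$ and $t>0$ consider the optimal control problem $$\min\left\{\int_0^t\frac12\|\boldsymbol{x}(s)-\boldsymbol{v}_0\|_M^2\,ds+\Phi(\boldsymbol{x}(0))\colon \boldsymbol{x}(t)=\boldsymbol{x},\ P^T\dot{\boldsymbol{x}}(s)\in\prod_{i=1}^n[-b_i,a_i]\ \forall s\in(0,t)\right\}.\quad(\ast)$$ Let $\boldsymbol{y}=(y_1,\dots,y_n):=P^T\boldsymbol{x}-P^T\boldsymbol{v}_0$ and define $$V(\boldsymbol{x},t):=\inf_{\boldsymbol{u}\in\prod_{i=1}^n[y_i-a_it,\,y_i+b_it]}\left\{\sum_{i=1}^nV(y_i,t;u_i,a_i,b_i)+\Phi\left((P^T)^{-1}\boldsymbol{u}+\boldsymbol{v}_0\right)\right\}.$$ Let $\boldsymbol{u}^*=(u_1^*,\dots,u_n^* )$ be any minimizer of this minimization problem, and define for $s\in[0,t]$ $$\boldsymbol{\gamma}(s;\boldsymbol{x},t):=(P^T)^{-1}\left(\gamma(s;y_1,t,u_1^*,a_1,b_1),\dots,\gamma(s;y_n,t,u_n^*,a_n,b_n)\right)+\boldsymbol{v}_0 .$$ Then,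 for any $\boldsymbol{x}\in\mathbb{R}^n$ and $t>0$, the function $[0,t]\ni s\mapsto\boldsymbol{\gamma}(s;\boldsymbol{x},t)\in\mathbb{R}^n$ is an optimal trajectory of $(\ast)$, and the optimal value of $(\ast)$ equals $V(\boldsymbol{x},t)$. Moreover, if $\Phi$ is convex, then $s\mapsto\boldsymbol{\gamma}(s;\boldsymbol{x},t)$ is the unique optimal trajectory.
   Context: The norm is $\|\boldsymbol{z}\|_M:=\sqrt{\langle\boldsymbol{z},M\boldsymbol{z}\rangle}$. In the control problem, trajectories $\boldsymbol{x}(\cdot)\colon[0,t]\to\mathbb{R}^n$ are Lipschitz functions, and the constraint on $\dot{\boldsymbol{x}}(s)$ is imposed at almost every $s\in(0,t)$ (where the derivative exists). One-dimensional functions. For $a,b>0$ define subsets $\Omega_i=\Omega_i(a,b)$ of $\mathbb{R}\times[0,+\infty)\times[0,+\infty)$ by $\Omega_1:=\{(x,t,u)\colon 0\le t<\frac ub,\ u-bt\le x\le u+at\}\cup\{(x,t,u)\colon t\ge\frac ub,\ at-\frac{au}{b}\le x\le u+at\}$, $\Omega_2:=\{(x,t,u)\colon t\ge\frac ub,\ 0\le x<at-\frac{au}{b}\}$, $\Omega_3:=\{(x,t,u)\colon t\ge\frac ub,\ u-bt\le x<0\}$. For $x\in\mathbb{R}$, $t\ge0$ and $u\ge0$, define $V(x,t;u,a,b)\in\mathbb{R}\cup\{+\infty\}$ by $V(x,t;u,a,b)=\frac{u^3}{6b}+\frac{x^3}{6a}-\left(\frac1{6a}+\frac1{6b}\right)\left(\frac{au+bx-abt}{a+b}\right)^3$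 if $(x,t,u)\in\Omega_1$; $\ =\frac{u^3}{6b}+\frac{x^3}{6a}$ if $(x,t,u)\in\Omega_2$; $\ =\frac{u^3}{6b}-\frac{x^3}{6b}$ if $(x,t,u)\in\Omega_3$; $\ =+\infty$ otherwise. For $u<0$, define $V(x,t;u,a,b):=V(-x,t;-u,b,a)$. This function is finite exactly when $u-bt\le x\le u+at$. For $u-bt\le x\le u+at$, the trajectory $[0,t]\ni s\mapsto\gamma(s;x,t,u,a,b)\in\mathbb{R}$ is defined as follows when $u\ge0$: if $(x,t,u)\in\Omega_1$: $\gamma=u-bs$ for $s\in[0,\frac{-x+u+at}{a+b})$ and $\gamma=a(s-t)+x$ for $s\in[\frac{-x+u+at}{a+b},t]$; if $(x,t,u)\in\Omega_2$: $\gamma=u-bs$ for $s\in[0,\frac ub)$, $\gamma=0$ for $s\in[\frac ub,t-\frac xa)$, $\gamma=a(s-t)+x$ for $s\in[t-\frac xa,t]$; if $(x,t,u)\in\Omega_3$: $\gamma=u-bs$ for $s\in[0,\frac ub)$, $\gamma=0$ for $s\in[\frac ub,t-\frac{|x|}b)$, $\gamma=-b(s-t)+x$ for $s\in[t-\frac{|x|}b,t]$. When $u<0$, $\gamma(s;x,t,u,a,b):=-\gamma(s;-x,t,-u,b,a)$. *)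

(* Defs.v *)
From HB Require Import structures.
From mathcomp Require Export all_boot all_order all_algebra.
From mathcomp Require Export all_classical all_reals all_analysis.

Set Implicit Arguments.
Unset Strict Implicit.
Unset Printing Implicit Defensive.

Import Order.TTheory GRing.Theory Num.Theory.
Import numFieldNormedType.Exports.

Local Open Scope classical_set_scope.
Local Open Scope ring_scope.

Definition dotv (R : realType) (n : nat) (z w : 'cV[R]_n) : R :=
  \sum_(i < n) z i 0 * w i 0.

Definition mxnorm (R : realType) (n : nat) (M : 'M[R]_n) (z : 'cV[R]_n) : R :=
  Num.sqrt (dotv z (M *m z)).

(* Points of Omega1, Omega2, Omega3 are triples ((x, t), u). *)
Definition Omega1 (R : realType) (a b : R) : set (R * R * R) :=
  [set p | let: (x, t, u) := p in [/\ 0 <= t, 0 <= u &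
     (t < u / b /\ u - b * t <= x <= u + a * t) \/
     (u / b <= t /\ a * t - a * u / b <= x <= u + a * t)]].

Definition Omega2 (R : realType) (a b : R) : set (R * R * R) :=
  [set p | let: (x, t, u) := p in
     [/\ 0 <= t, 0 <= u, u / b <= t & 0 <= x < a * t - a * u / b]].

Definition Omega3 (R : realType) (a b : R) : set (R * R * R) :=
  [set p | let: (x, t, u) := p in
     [/\ 0 <= t, 0 <= u, u / b <= t & u - b * t <= x < 0]].

Definition V1_nneg (R : realType) (x t u a b : R) : \bar R :=
  if (x, t, u) \in Omega1 a b then
    (u ^+ 3 / (6 * b) + x ^+ 3 / (6 * a)
     - (1 / (6 * a) + 1 / (6 * b))
       * ((a * u + b * x - a * b * t) / (a + b)) ^+ 3)%:E
  else if (x, t, u) \in Omega2 a b then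
    (u ^+ 3 / (6 * b) + x ^+ 3 / (6 * a))%:E
  else if (x, t, u) \in Omega3 a b then
    (u ^+ 3 / (6 * b) - x ^+ 3 / (6 * b))%:E
  else +oo%E.

Definition V1 (R : realType) (x t u a b : R) : \bar R :=
  if 0 <= u then V1_nneg x t u a b else V1_nneg (- x) t (- u) b a.

(* Only the values for u - b t <= x <= u + a t and 0 <= s <= t are meaningful;
   outside the three regions the value 0 is arbitrary. *)
Definition gamma1_nneg (R : realType) (s x t u a b : R) : R :=
  if (x, t, u) \in Omega1 a b then
    if s < (- x + u + a * t) / (a + b) then u - b * s else a * (s - t) + x
  else if (x, t, u) \in Omega2 a b then
    if s < u / b then u - b * s
    else if s < t - x / a then 0
    else a * (s - t) + x
  else if (x, t, u) \in Omega3 a b then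
    if s < u / b then u - b * s
    else if s < t - `|x| / b then 0
    else - b * (s - t) + x
  else 0.

Definition gamma1 (R : realType) (s x t u a b : R) : R :=
  if 0 <= u then gamma1_nneg s x t u a b
  else - gamma1_nneg s (- x) t (- u) b a.

(* A trajectory on [0, t] is represented by a total function R -> R^n, of which
   only the restriction to [0, t] matters.  The derivative is required to exist
   almost everywhere because derive1 z has a default value where it does not; for
   Lipschitz z this is no restriction. *)
Definition admissible (R : realType) (n : nat) (P : 'M[R]_n) (a b x : 'cV[R]_n)
    (t : R) : set (R -> 'cV[R]_n) :=
  [set z | [/\ [lipschitz z s | s in `[0, t]],
     z t = x &
     {ae @lebesgue_measure R, forall s, 0 < s < t ->
        derivable z s 1 /\
        forall i, - b i 0 <= (P^T *m derive1 z s) i 0 <= a i 0}]].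

Definition cost (R : realType) (n : nat) (Phi : 'cV[R]_n -> R) (M : 'M[R]_n)
    (v0 : 'cV[R]_n) (t : R) (z : R -> 'cV[R]_n) : \bar R :=
  (\int[@lebesgue_measure R]_(s in `[0%R, t])
     (1 / 2 * mxnorm M (z s - v0) ^+ 2)%:E + (Phi (z 0))%:E)%E.

Definition optimal_value (R : realType) (n : nat) (Phi : 'cV[R]_n -> R)
    (P : 'M[R]_n) (a b v0 x : 'cV[R]_n) (t : R) : \bar R :=
  ereal_inf [set cost Phi (P *m P^T) v0 t z | z in admissible P a b x t].

Definition optimal_trajectory (R : realType) (n : nat) (Phi : 'cV[R]_n -> R)
    (P : 'M[R]_n) (a b v0 x : 'cV[R]_n) (t : R) (z : R -> 'cV[R]_n) : Prop :=
  admissible P a b x t z /\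
  forall w, admissible P a b x t w ->
    (cost Phi (P *m P^T) v0 t z <= cost Phi (P *m P^T) v0 t w)%E.

Definition ycoord (R : realType) (n : nat) (P : 'M[R]_n) (v0 x : 'cV[R]_n) :
  'cV[R]_n := P^T *m x - P^T *m v0.

Definition Vbox (R : realType) (n : nat) (P : 'M[R]_n) (a b v0 x : 'cV[R]_n)
    (t : R) : set 'cV[R]_n :=
  [set u | forall i, ycoord P v0 x i 0 - a i 0 * t <= u i 0
                     <= ycoord P v0 x i 0 + b i 0 * t].

Definition Vobj (R : realType) (n : nat) (Phi : 'cV[R]_n -> R) (P : 'M[R]_n)
    (a b v0 x : 'cV[R]_n) (t : R) (u : 'cV[R]_n) : \bar R :=
  (\sum_(i < n) (V1 (ycoord P v0 x i 0) t (u i 0) (a i 0) (b i 0))%R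
   + (Phi (invmx P^T *m u + v0)%R)%:E)%E.

Definition Vfun (R : realType) (n : nat) (Phi : 'cV[R]_n -> R) (P : 'M[R]_n)
    (a b v0 x : 'cV[R]_n) (t : R) : \bar R :=
  ereal_inf [set Vobj Phi P a b v0 x t u | u in Vbox P a b v0 x t].

Definition Vminimizer (R : realType) (n : nat) (Phi : 'cV[R]_n -> R)
    (P : 'M[R]_n) (a b v0 x : 'cV[R]_n) (t : R) (u : 'cV[R]_n) : Prop :=
  Vbox P a b v0 x t u /\
  forall w, Vbox P a b v0 x t w ->
    (Vobj Phi P a b v0 x t u <= Vobj Phi P a b v0 x t w)%E.

Definition gamma (R : realType) (n : nat) (P : 'M[R]_n) (a b v0 x : 'cV[R]_n)
    (t : R) (u : 'cV[R]_n) (s : R) : 'cV[R]_n :=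
  invmx P^T *m
    (\col_(i < n) gamma1 s (ycoord P v0 x i 0) t (u i 0) (a i 0) (b i 0)) + v0.

(* Main.v *)
Require Import Defs.
From mathcomp Require Import ring lra.
Set Implicit Arguments.
Unset Strict Implicit.
Unset Printing Implicit Defensive.
Import Order.TTheory GRing.Theory Num.Theory.
Import numFieldNormedType.Exports.
Local Open Scope classical_set_scope.
Local Open Scope ring_scope.

(** Put w = P^T (z - v0).  Since z - v0 has squared M-norm equal to the Euclidean
    squared norm of w, the running cost splits into the sum of the integrals of
    w_i^2 / 2, and the constraint becomes -b_i <= w_i' <= a_i almost everywhere.
    For Lipschitz curves this says exactly that every increment of w_i over [s, r]
    lies between -b_i (r - s) and a_i (r - s) ([ae_derive1_le]).

    Fix the end points w_i(0) = u_i and w_i(t) = y_i.  The increment bounds,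
    applied from both ends, confine w_i(s) to an interval whose bounds are the
    lower and upper envelopes below.  The curve s |-> point of that interval
    nearest to 0 obeys the same increment bounds and minimizes w_i(s)^2 at every
    single time s ([nearest0_minimal]), hence minimizes the integral.  This curve
    is gamma ([gamma1_nearest0]): it runs towards 0 at full speed, rests there if
    there is time, and leaves for y_i at full speed.  Integrating its square on
    the affine pieces gives the explicit V ([V1_energy]).

    So the cost of a trajectory z is at least the objective of the finite
    dimensional problem at u = P^T (z(0) - v0), with equality for gamma; the two
    infima agree, and minimizers u yield optimal trajectories.  A minimizer
    exists because the box of admissible u is compact, the energies depend
    continuously on u ([energy_nearest0_continuous]) and Phi is lower
    semicontinuous.

    If Phi is convex, the midpoint of two optimal trajectories is again feasible,
    and the parallelogram identity ([energy_parallelogram]) shows that it would be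
    strictly cheaper unless the integral of the squared difference vanishes; a
    continuous function with vanishing square integral is 0. *)

(** * Increments of Lipschitz functions with a.e. bounded derivative *)

(** A continuous-induction argument: the supremum of the points at which h stays
    below h p still belongs to that set by the one-sided growth bound, and the
    local decrease to its right forbids it to be smaller than q. *)
Lemma le_of_locally_le (R : realType) (h : R -> R) (p q M : R) :
  p <= q -> 0 <= M ->
  (forall x y, p <= x -> x <= y -> y <= q -> h y - h x <= M * (y - x)) ->
  (forall c, p <= c -> c < q ->
     exists2 d, 0 < d & forall s, c < s -> s < c + d -> s <= q -> h s <= h c) ->
  h q <= h p.
Proof.
move=> pq M0 hM hloc.
pose S := [set s | [/\ p <= s, s <= q & h s <= h p]].
have Sp : S p by split.
have supS : has_sup S by split; [exists p | exists q => s []].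
set c := sup S.
have pc : p <= c by apply: ub_le_sup => //; case: supS.
have cq : c <= q by apply: ge_sup; [exists p | move=> s []].
have hc : h c <= h p.
  apply/ler_addgt0Pr => e e0.
  have e10 : 0 < e / (M + 1) by rewrite divr_gt0//; lra.
  have [s [ps sq hs] cs] := sup_adherent e10 supS.
  have sc : s <= c by apply: ub_le_sup => //; case: supS.
  have := hM _ _ ps sc cq.
  have : M * (c - s) <= e.
    have -> : e = (M + 1) * (e / (M + 1)) by field; lra.
    rewrite -/c in cs; apply: ler_pM => //; lra.
  lra.
have [ltcq|qc] := ltP c q; last by have -> : q = c by lra.
have [d d0 hd] := hloc _ pc ltcq.
have hs s : c < s -> s < c + d -> s <= q -> s <= c.
  move=> cs sd sq; apply: ub_le_sup; first by case: supS.
  by split => //; [lra | exact: le_trans (hd _ cs sd sq) hc].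
exfalso.
have [cdq|cdq] := leP (c + d / 2) q.
  by have := hs (c + d / 2); lra.
by have := hs q; lra.
Qed.

Lemma derive1_le_near (R : realType) (f : R -> R) (s c e : R) : 0 < e ->
  derivable f s 1 -> derive1 f s <= c ->
  exists2 d, 0 < d & forall y, s < y -> y < s + d ->
    f y - f s <= (c + e) * (y - s).
Proof.
move=> e0 df fc.
have /cvgrPdist_lt/(_ _ e0) [d /= d0 hd] := df.
exists d => // y sy yd.
have ys0 : 0 < y - s by lra.
have := hd (y - s); rewrite /ball_/= sub0r normrN gtr0_norm// => /(_ ltac:(lra)).
have /[swap]/[apply] : y - s != 0 by rewrite gt_eqF.
rewrite -/(derive f s 1) -derive1E.
rewrite /GRing.scale/= mulr1 subrK ltr_distlC => /andP[_ hlt].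
have -> : f y - f s = ((y - s)^-1 * (f y - f s)) * (y - s) by field; lra.
by rewrite ler_pM2r//; lra.
Qed.

(** Cover the null set of bad times by an open U of measure at most e, and
    subtract from f both (c + e) s and a large multiple of the measure g of U to
    the left of s.  The result decreases locally: at a good time because of the
    derivative, at a time of U because g then grows at unit rate and outweighs
    the Lipschitz constant.  Hence it decreases, and e is arbitrary. *)
Lemma ae_derive1_le (R : realType) (f : R -> R) (K c t : R) : 0 <= K ->
  (forall x y, 0 <= x -> x <= y -> y <= t -> `|f y - f x| <= K * (y - x)) ->
  {ae @lebesgue_measure R, forall s, 0 < s < t ->
     derivable f s 1 /\ derive1 f s <= c} ->
  forall x y, 0 <= x -> x <= y -> y <= t -> f y - f x <= c * (y - x).
Proof.
set mu := @lebesgue_measure R.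
move=> K0 fK [B [mB B0 subB]] p q p0 pq qt.
suff main e : 0 < e -> f q - f p <= (c + e) * (q - p) + (K + `|c| + e) * e.
  apply/ler_addgt0Pr => e e0.
  (* For r <= 1 the error of the bound at r is at most r * C. *)
  pose C := (q - p) + (K + `|c| + 1).
  have C1 : 1 <= C by have := normr_ge0 c; rewrite /C; lra.
  pose r := Num.min 1 (e / C).
  have r0 : 0 < r by rewrite lt_min ltr01 divr_gt0//; lra.
  have r1 : r <= 1 by rewrite ge_min lexx.
  have rC : r * C <= e.
    have -> : e = e / C * C by field; lra.
    by apply: ler_wpM2r; [lra|rewrite ge_min lexx orbT].
  have := main r r0.
  have : (K + `|c| + r) * r <= (K + `|c| + 1) * r by apply: ler_wpM2r; lra.
  rewrite /C in rC; lra.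
move=> e0; set L := K + `|c| + e.
have L0 : 0 <= L by have := normr_ge0 c; rewrite /L; lra.
(* The time 0, where no derivative is assumed, is treated as a bad time. *)
have mD : measurable (B `|` [set 0 : R]) by exact: measurableU.
have D0 : mu (B `|` [set 0 : R]) = 0.
  by apply: null_set_setU => //; exact: lebesgue_measure_set1.
have [|U [oU DU muU]] := lebesgue_regularity_outer mD _ e0.
  by rewrite [X in (X < _)%E]D0 ltry.
have mU : measurable U by exact: measurable_realfun.open_measurable.
have muUe : (mu U <= e%:E)%E.
  rewrite -(setDUK DU) -/mu; apply: (le_trans (measureU2 _ _ _)) => //.
    exact: measurableD.
  by rewrite -/mu [X in (X + _)%E]D0 add0e ltW.
pose g (s : R) := fine (mu (U `&` `]p, s])).
have mI (x y : R) : measurable (U `&` `]x, y]) by exact: measurableI.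
have gfin (s : R) : mu (U `&` `]p, s]) \is a fin_num.
  rewrite ge0_fin_numE//; apply: le_lt_trans (ltry e).
  by apply: le_trans muUe; apply: le_measure; rewrite ?inE//; exact: mI.
have g0 (s : R) : 0 <= g s by exact: fine_ge0.
have gq : g q <= e.
  rewrite -lee_fin fineK//; apply: le_trans muUe.
  by apply: le_measure; rewrite ?inE//; exact: mI.
have gpp : g p = 0 by rewrite /g set_itvoc0 setI0 /mu measure0.
have gD x y : p <= x -> x <= y -> exists r, [/\ g y = g x + r, 0 <= r &
     (`]x, y] `<=` U -> r = y - x)].
  move=> px xy; exists (fine (mu (U `&` `]x, y]))); split.
  - rewrite /g -fineD//; last first.
      rewrite ge0_fin_numE//; apply: le_lt_trans (ltry e).
      by apply: le_trans muUe; apply: le_measure; rewrite ?inE//; exact: mI.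
    congr fine; rewrite -[RHS](measureU mu); [|exact: mI|exact: mI|].
      rewrite -setIUr; congr (mu (_ `&` _)).
      by rewrite -itv_bndbnd_setU ?bnd_simp.
    apply/seteqP; split=> // z [[_ +] [_ +]].
    rewrite /= !in_itv/=; lra.
  - exact: fine_ge0.
  - move=> /setIidr ->; rewrite /mu lebesgue_measure_itv/= lte_fin.
    case: ltP => //= yx; lra.
pose h (s : R) := f s - (c + e) * s - L * g s.
suff : h q <= h p.
  rewrite /h gpp; have : L * g q <= L * e by exact: ler_wpM2l.
  lra.
apply: (@le_of_locally_le _ h p q (K + `|c| + e)) => //.
- move=> x y px xy yq; rewrite /h.
  have [r [-> r0 _]] := gD _ _ px xy.
  have := fK x y (le_trans p0 px) xy (le_trans yq qt).
  rewrite ler_norml => /andP[_ fxy].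
  have : 0 <= L * r by exact: mulr_ge0.
  have : - `|c| * (y - x) <= c * (y - x).
    by apply: ler_wpM2r; [lra | rewrite lerNnormlW].
  have : 0 <= e * (y - x) by apply: mulr_ge0; lra.
  lra.
- move=> x px xq.
  have [xU|xU] := pselect (U x).
    have [d /= d0 dU] : exists2 d, 0 < d & forall y, `|x - y| < d -> U y.
      have := open_nbhs_nbhs (conj oU xU).
      by rewrite -nbhs_ballE => -[d /= d0 dU]; exists d.
    exists d => // s xs sd sq; rewrite /h.
    have [r [-> r0 ->]] := gD _ _ px (ltW xs); last first.
      move=> z /=; rewrite in_itv/= => /andP[xz zs]; apply: dU.
      by rewrite distrC gtr0_norm ?subr_gt0// ltrBlDl (le_lt_trans zs).
    have := fK x s (le_trans p0 px) (ltW xs) (le_trans sq qt).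
    rewrite ler_norml => /andP[_ fxy].
    have : - `|c| * (s - x) <= c * (s - x).
      by apply: ler_wpM2r; [lra | rewrite lerNnormlW].
    have : 0 <= e * (s - x) by apply: mulr_ge0; lra.
    rewrite /L; lra.
  have x0 : x != 0 by apply/eqP => x0; apply: xU; apply: DU; right.
  have xpos : 0 < x by rewrite lt_neqAle eq_sym x0 (le_trans p0 px).
  have [df dfc] : derivable f x 1 /\ derive1 f x <= c.
    apply: contrapT => nd; apply: xU; apply: DU; left; apply: subB => /= H.
    by apply: nd; apply: H; rewrite xpos (lt_le_trans xq qt).
  have [d d0 hd] := derive1_le_near e0 df dfc.
  exists d => // s xs sd sq; rewrite /h.
  have [r [-> r0 _]] := gD _ _ px (ltW xs).
  have := hd _ xs sd.
  have : 0 <= L * r by exact: mulr_ge0.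
  lra.
Qed.

(** * Slope-bounded curves and the curve nearest to zero *)

(** The integrated form of -b <= f' <= a on [0, t]: it makes sense without
    derivatives and is stable under maxima, minima and midpoints. *)
Definition slope_bounded (R : realType) (a b t : R) (f : R -> R) : Prop :=
  forall s r, 0 <= s -> s <= r -> r <= t ->
    - b * (r - s) <= f r - f s <= a * (r - s).

(** The two envelopes are the extreme values at time s of curves with slopes in
    [-b, a] going from u at time 0 to x at time t. *)
Definition lower_envelope (R : realType) (x t u a b s : R) : R :=
  Num.max (u - b * s) (x - a * (t - s)).

Definition upper_envelope (R : realType) (x t u a b s : R) : R :=
  Num.min (u + a * s) (x + b * (t - s)).

(** The metric projection of 0 onto the interval between the two envelopes. *)
Definition nearest0 (R : realType) (x t u a b s : R) : R :=
  Num.max (lower_envelope x t u a b s) (Num.min 0 (upper_envelope x t u a b s)).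

Lemma slope_bounded_affine (R : realType) (a b t c m : R) : - b <= m -> m <= a ->
  slope_bounded a b t (fun s => c + m * s).
Proof.
move=> bm ma s r _ sr _.
have -> : c + m * r - (c + m * s) = m * (r - s) by ring.
by rewrite !ler_wpM2r// subr_ge0.
Qed.

Lemma slope_bounded_max (R : realType) (a b t : R) (f g : R -> R) :
  slope_bounded a b t f -> slope_bounded a b t g ->
  slope_bounded a b t (fun s => Num.max (f s) (g s)).
Proof.
move=> hf hg s r s0 sr rt; move: (hf _ _ s0 sr rt) (hg _ _ s0 sr rt).
by rewrite /Num.max; do 2 case: ltP => ?; lra.
Qed.

Lemma slope_bounded_min (R : realType) (a b t : R) (f g : R -> R) :
  slope_bounded a b t f -> slope_bounded a b t g ->
  slope_bounded a b t (fun s => Num.min (f s) (g s)).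
Proof.
move=> hf hg s r s0 sr rt; move: (hf _ _ s0 sr rt) (hg _ _ s0 sr rt).
by rewrite /Num.min; do 2 case: ltP => ?; lra.
Qed.

Lemma slope_bounded_midpoint (R : realType) (a b t : R) (f g : R -> R) :
  slope_bounded a b t f -> slope_bounded a b t g ->
  slope_bounded a b t (fun s => (f s + g s) / 2).
Proof.
move=> hf hg s r s0 sr rt; move: (hf _ _ s0 sr rt) (hg _ _ s0 sr rt).
lra.
Qed.

Lemma slope_bounded_lipschitz (R : realType) (a b t : R) (f : R -> R) (s r : R) : 0 <= a -> 0 <= b ->
  slope_bounded a b t f -> 0 <= s <= t -> 0 <= r <= t ->
  `|f s - f r| <= (a + b) * `|s - r|.
Proof.
move=> a0 b0 hf; wlog sr : s r / s <= r => [hw hs hr|/andP[s0 _] /andP[_ rt]].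
  have [/ltW sr|rs] := ltP s r; first exact: hw.
  by rewrite distrC [X in _ * X]distrC; exact: hw.
rewrite distrC [X in _ * X]distrC [X in _ * X]ger0_norm ?subr_ge0//.
have := hf _ _ s0 sr rt.
have : 0 <= a * (r - s) by rewrite mulr_ge0// subr_ge0.
have : 0 <= b * (r - s) by rewrite mulr_ge0// subr_ge0.
rewrite ler_norml; lra.
Qed.

Lemma slope_bounded_continuous (R : realType) (a b t : R) (f : R -> R) : 0 <= a -> 0 <= b ->
  slope_bounded a b t f -> {within `[0, t], continuous f}.
Proof.
move=> a0 b0 hf; apply/subspace_continuousP => s /=; rewrite in_itv/= => st.
have ab0 : 0 < a + b + 1 by lra.
apply/cvgrPdist_lt => e e0; near=> r.
have rt : 0 <= r <= t.
  by near: r; apply: filterS (withinT _ _) => r /=; rewrite in_itv.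
apply: (le_lt_trans (slope_bounded_lipschitz a0 b0 hf st rt)).
apply: (@le_lt_trans _ _ ((a + b + 1) * `|s - r|)).
  by apply: ler_wpM2r => //; lra.
rewrite mulrC -ltr_pdivlMr//; near: r; rewrite near_withinE.
by exists (e / (a + b + 1)) => [/=|r /= sr _ //]; rewrite divr_gt0.
Unshelve. all: by end_near. Qed.

Lemma slope_bounded_nearest0 (R : realType) (x t u a b : R) : 0 <= a -> 0 <= b ->
  slope_bounded a b t (nearest0 x t u a b).
Proof.
move=> a0 b0; have affine c m : - b <= m -> m <= a ->
    slope_bounded a b t (fun s => c + m * s) by exact: slope_bounded_affine.
have e0 : (fun s => x - a * (t - s)) = (fun s => x - a * t + a * s).
  by apply/funext => s; ring.
have e1 : (fun s => x + b * (t - s)) = (fun s => x + b * t + - b * s).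
  by apply/funext => s; ring.
have e2 : (fun s => u - b * s) = (fun s => u + - b * s).
  by apply/funext => s; ring.
have e3 : (fun=> 0) = (fun s => 0 + 0 * s) :> (R -> R).
  by apply/funext => s; ring.
apply: slope_bounded_max.
  apply: slope_bounded_max; first by rewrite e2; apply: affine; lra.
  by rewrite e0; apply: affine; lra.
apply: slope_bounded_min; first by rewrite e3; apply: affine; lra.
apply: slope_bounded_min; first by apply: affine; lra.
by rewrite e1; apply: affine; lra.
Qed.

(** Such a w takes its values between the two envelopes, where nearest0 has the
    least absolute value. *)
Lemma nearest0_minimal (R : realType) (t a b : R) (w : R -> R) (s : R) :
  slope_bounded a b t w -> 0 <= s <= t ->
  nearest0 (w t) t (w 0) a b s ^+ 2 <= w s ^+ 2.
Proof.
move=> hw /andP[s0 st].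
move: (hw 0 s (lexx _) s0 st) (hw s t s0 st (lexx _)); rewrite !subr0 => h1 h2.
rewrite -[leRHS]real_normK ?num_real// -[leLHS]real_normK ?num_real//.
apply: lerXn2r; rewrite ?nnegrE//.
have Lw : lower_envelope (w t) t (w 0) a b s <= w s.
  by rewrite /lower_envelope ge_max; lra.
have wU : w s <= upper_envelope (w t) t (w 0) a b s.
  by rewrite /upper_envelope le_min; lra.
rewrite /nearest0; move: Lw wU.
set L := lower_envelope _ _ _ _ _ _; set U := upper_envelope _ _ _ _ _ _.
move=> Lw wU; case: (leP 0 U) => U0; last first.
  by rewrite max_r ?ltr0_norm; lra.
case: (leP L 0) => L0; first by rewrite normr0.
by rewrite !ger0_norm; lra.
Qed.

(** Each envelope is moved by at most |u - v|, and maxima and minima do not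
    amplify perturbations. *)
Lemma nearest0_dist (R : realType) (x t u v a b s : R) :
  `|nearest0 x t u a b s - nearest0 x t v a b s| <= `|u - v|.
Proof.
wlog uv : u v / u <= v => [hw|].
  have [/ltW uv|vu] := ltP u v; first exact: hw.
  by rewrite distrC [leRHS]distrC; exact: hw.
have max_shift (p q p' q' : R) : p <= q <= p + (v - u) -> p' <= q' <= p' + (v - u) ->
    Num.max p p' <= Num.max q q' <= Num.max p p' + (v - u).
  by rewrite /Num.max; do 2 case: ltP => ?; lra.
have min_shift (p q p' q' : R) : p <= q <= p + (v - u) -> p' <= q' <= p' + (v - u) ->
    Num.min p p' <= Num.min q q' <= Num.min p p' + (v - u).
  by rewrite /Num.min; do 2 case: ltP => ?; lra.
suff : nearest0 x t u a b s <= nearest0 x t v a b s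
    <= nearest0 x t u a b s + (v - u).
  by move=> h; rewrite distrC [leRHS]distrC ler_norml ger0_norm; lra.
apply: (max_shift); first by apply: (max_shift); lra.
by apply: (min_shift); [lra | apply: (min_shift); lra].
Qed.

Lemma nearest0_start (R : realType) (x t u a b : R) :
  u - b * t <= x <= u + a * t -> nearest0 x t u a b 0 = u.
Proof.
move=> hx; rewrite /nearest0.
have -> : lower_envelope x t u a b 0 = u.
  by rewrite /lower_envelope max_l; lra.
have -> : upper_envelope x t u a b 0 = u.
  by rewrite /upper_envelope min_l; lra.
by case: (leP 0 u) => u0; [rewrite max_l | rewrite max_r].
Qed.

Lemma nearest0_end (R : realType) (x t u a b : R) :
  u - b * t <= x <= u + a * t -> nearest0 x t u a b t = x.
Proof.
move=> hx; rewrite /nearest0.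
have -> : lower_envelope x t u a b t = x.
  by rewrite /lower_envelope max_r; lra.
have -> : upper_envelope x t u a b t = x.
  by rewrite /upper_envelope min_r; lra.
by case: (leP 0 x) => x0; [rewrite max_l | rewrite max_r].
Qed.

(** Reflection in 0 exchanges the roles of a and b and of the two envelopes; it
    matches the definitions of V and gamma for negative u.  The max-min formula is
    not visibly symmetric: the envelopes have to be in the right order. *)
Lemma nearest0N (R : realType) (x t u a b s : R) : 0 <= a -> 0 <= b ->
  u - b * t <= x <= u + a * t -> 0 <= s <= t ->
  nearest0 (- x) t (- u) b a s = - nearest0 x t u a b s.
Proof.
move=> a0 b0 hx hs.
have : 0 <= a * s by rewrite mulr_ge0//; lra.
have : 0 <= b * s by rewrite mulr_ge0//; lra.
have : 0 <= a * (t - s) by rewrite mulr_ge0//; lra.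
have : 0 <= b * (t - s) by rewrite mulr_ge0//; lra.
move=> h1 h2 h3 h4.
have LU : lower_envelope x t u a b s <= upper_envelope x t u a b s.
  by rewrite /lower_envelope /upper_envelope le_min !ge_max; lra.
rewrite /nearest0.
have -> : lower_envelope (- x) t (- u) b a s = - upper_envelope x t u a b s.
  by rewrite /lower_envelope /upper_envelope oppr_min; congr Num.max; ring.
have -> : upper_envelope (- x) t (- u) b a s = - lower_envelope x t u a b s.
  by rewrite /lower_envelope /upper_envelope oppr_max; congr Num.min; ring.
set L := lower_envelope _ _ _ _ _ _ in LU *.
set U := upper_envelope _ _ _ _ _ _ in LU *.
case: (leP 0 U) => U0; last first.
  by rewrite (max_r LU) min_l ?max_l//; lra.
case: (leP L 0) => L0.
  by rewrite (min_l (_ : 0 <= - L)) ?max_r ?oppr0//; lra.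
by rewrite (min_r (_ : - L <= 0)) ?max_r//; lra.
Qed.

(** * The explicit curve is the nearest one *)

Lemma Omega_cover (R : realType) (x t u a b : R) : 0 < b -> 0 <= t -> 0 <= u ->
  u - b * t <= x <= u + a * t ->
  [\/ Omega1 a b (x, t, u), Omega2 a b (x, t, u) | Omega3 a b (x, t, u)].
Proof.
move=> b0 t0 u0 hx.
have [tub|ubt] := ltP t (u / b); first by apply: Or31; split => //; left.
have [xlt|ltx] := ltP x (a * t - a * u / b); last first.
  by apply: Or31; split => //; right; split => //; lra.
have [x0|x0] := ltP x 0; first by apply: Or33; split => //; lra.
by apply: Or32; split => //; lra.
Qed.

(** In this region the descending line from u and the ascending line to x meet
    at time c at a height that is still nonnegative, so the curve never rests. *)
Lemma nearest0_Omega1 (R : realType) (x t u a b : R) : 0 < a -> 0 < b ->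
  u - b * t <= x <= u + a * t -> Omega1 a b (x, t, u) ->
  let c := (- x + u + a * t) / (a + b) in
  [/\ 0 <= c <= t,
      forall s, 0 <= s -> s <= c -> nearest0 x t u a b s = u - b * s,
      forall s, c <= s -> s <= t -> nearest0 x t u a b s = a * (s - t) + x &
      u - b * c = (a * u + b * x - a * b * t) / (a + b)].
Proof.
move=> a0 b0 hx [t0 u0 hO] c.
have ab0 : 0 < a + b by lra.
have cE : (a + b) * c = - x + u + a * t by rewrite /c; field; lra.
have c0 : 0 <= c by rewrite divr_ge0//; lra.
have ct : c <= t by rewrite ler_pdivrMr//; lra.
have vE : u - b * c = (a * u + b * x - a * b * t) / (a + b).
  by rewrite /c; field; lra.
have v0 : 0 <= u - b * c.
  have [[tub _]|[ubt /andP[xge _]]] := hO.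
    have : b * c <= b * t by rewrite ler_pM2l.
    by move: tub; rewrite ltr_pdivlMr//; lra.
  rewrite vE; apply: divr_ge0; last by lra.
  have : b * (a * t - a * u / b) <= b * x by rewrite ler_pM2l.
  have -> : b * (a * t - a * u / b) = b * a * t - a * u by field; lra.
  by lra.
split => //; first by rewrite c0.
- move=> s s0 sc.
  have h1 : b * s <= b * c by rewrite ler_pM2l.
  have h2 : (a + b) * s <= (a + b) * c by rewrite ler_pM2l.
  rewrite /nearest0 /lower_envelope [X in Num.max X _]max_l; last by lra.
  by rewrite max_l// ge_min; lra.
- move=> s cs st.
  have h1 : a * c <= a * s by rewrite ler_pM2l.
  have h2 : (a + b) * c <= (a + b) * s by rewrite ler_pM2l.
  rewrite /nearest0 /lower_envelope [X in Num.max X _]max_r; last by lra.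
  rewrite max_l; first by lra.
  by rewrite ge_min; lra.
Qed.

(** Here the curve has time to reach 0 at c and to rest there until d. *)
Lemma nearest0_Omega2 (R : realType) (x t u a b : R) : 0 < a -> 0 < b ->
  Omega2 a b (x, t, u) ->
  let c := u / b in let d := t - x / a in
  [/\ 0 <= c, c <= d & d <= t] /\
  [/\ forall s, 0 <= s -> s <= c -> nearest0 x t u a b s = u - b * s,
      forall s, c <= s -> s <= d -> nearest0 x t u a b s = 0 &
      forall s, d <= s -> s <= t -> nearest0 x t u a b s = a * (s - t) + x].
Proof.
move=> a0 b0 [t0 u0 ubt /andP[x0 xlt]] c d.
have bc : b * c = u by rewrite /c; field; lra.
have ad : a * d = a * t - x by rewrite /d; field; lra.
have c0 : 0 <= c by rewrite divr_ge0//; lra.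
have dt : d <= t by rewrite /d gerBl divr_ge0// ltW.
have cd : c <= d.
  rewrite -(ler_pM2l a0) ad.
  have -> : a * c = a * u / b by rewrite /c; field; lra.
  lra.
split => //; split.
- move=> s s0 sc.
  have h1 : b * s <= b * c by rewrite ler_pM2l.
  have h2 : a * s <= a * d by rewrite ler_pM2l// (le_trans sc).
  rewrite /nearest0 /lower_envelope [X in Num.max X _]max_l; last by lra.
  by rewrite max_l// ge_min; lra.
- move=> s cs sd.
  have h1 : b * c <= b * s by rewrite ler_pM2l.
  have h2 : a * s <= a * d by rewrite ler_pM2l.
  have h3 : 0 <= a * s by rewrite mulr_ge0//; lra.
  have h4 : 0 <= b * (t - s) by rewrite mulr_ge0//; lra.
  rewrite /nearest0 /lower_envelope /upper_envelope.
  by rewrite [X in Num.max _ X]min_l ?le_min; [rewrite max_r// ge_max|]; lra.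
- move=> s ds st.
  have h1 : b * c <= b * s by rewrite ler_pM2l// (le_trans cd).
  have h2 : a * d <= a * s by rewrite ler_pM2l.
  rewrite /nearest0 /lower_envelope [X in Num.max X _]max_r; last by lra.
  rewrite max_l; first by lra.
  by rewrite ge_min; lra.
Qed.

Lemma nearest0_Omega3 (R : realType) (x t u a b : R) : 0 < a -> 0 < b ->
  Omega3 a b (x, t, u) ->
  let c := u / b in let d := t - `|x| / b in
  [/\ 0 <= c, c <= d & d <= t] /\
  [/\ forall s, 0 <= s -> s <= c -> nearest0 x t u a b s = u - b * s,
      forall s, c <= s -> s <= d -> nearest0 x t u a b s = 0 &
      forall s, d <= s -> s <= t -> nearest0 x t u a b s = - b * (s - t) + x].
Proof.
move=> a0 b0 [t0 u0 ubt /andP[xge x0]] c d.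
have bc : b * c = u by rewrite /c; field; lra.
have bd : b * d = b * t + x by rewrite /d ltr0_norm//; field; lra.
have c0 : 0 <= c by rewrite divr_ge0//; lra.
have dt : d <= t by rewrite /d gerBl divr_ge0// ltW.
have cd : c <= d by rewrite -(ler_pM2l b0) bd bc; lra.
split => //; split.
- move=> s s0 sc.
  have h1 : b * s <= b * c by rewrite ler_pM2l.
  have h2 : 0 <= a * (t - s) by rewrite mulr_ge0//; lra.
  rewrite /nearest0 /lower_envelope [X in Num.max X _]max_l; last by lra.
  by rewrite max_l// ge_min; lra.
- move=> s cs sd.
  have h1 : b * c <= b * s by rewrite ler_pM2l.
  have h2 : b * s <= b * d by rewrite ler_pM2l.
  have h3 : 0 <= a * s by rewrite mulr_ge0//; lra.
  have h4 : 0 <= a * (t - s) by rewrite mulr_ge0//; lra.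
  rewrite /nearest0 /lower_envelope /upper_envelope.
  by rewrite [X in Num.max _ X]min_l ?le_min; [rewrite max_r// ge_max|]; lra.
- move=> s ds st.
  have h1 : b * d <= b * s by rewrite ler_pM2l.
  have h2 : 0 <= a * s by rewrite mulr_ge0//; lra.
  have h3 : 0 <= a * (t - s) by rewrite mulr_ge0//; lra.
  have h4 : 0 <= b * (t - s) by rewrite mulr_ge0//; lra.
  rewrite /nearest0 /lower_envelope /upper_envelope.
  rewrite [X in Num.min _ X]min_r; last by lra.
  rewrite [X in Num.max _ X]min_r; last by lra.
  by rewrite max_r ?ge_max; lra.
Qed.

(** In each region the nearest curve is read off piece by piece; negative u is
    reduced to positive u by reflection. *)
Lemma gamma1_nearest0 (R : realType) (x t u a b s : R) : 0 < a -> 0 < b ->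
  u - b * t <= x <= u + a * t -> 0 <= s <= t ->
  gamma1 s x t u a b = nearest0 x t u a b s.
Proof.
have nneg y v c d : 0 < c -> 0 < d -> 0 <= v -> v - d * t <= y <= v + c * t ->
    0 <= s <= t -> gamma1_nneg s y t v c d = nearest0 y t v c d s.
  move=> c0 d0 v0 hy /andP[s0 st]; rewrite /gamma1_nneg.
  case: ifPn => [/set_mem O1|/negP nO1].
    have [_ p1 p2 _] := nearest0_Omega1 c0 d0 hy O1.
    by case: ltP => sc; [rewrite p1// ltW | rewrite p2].
  case: ifPn => [/set_mem O2|/negP nO2].
    have [_ [p1 p2 p3]] := nearest0_Omega2 c0 d0 O2.
    case: ltP => sc; first by rewrite p1// ltW.
    by case: ltP => sd; [rewrite p2// ltW | rewrite p3].
  case: ifPn => [/set_mem O3|/negP nO3].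
    have [_ [p1 p2 p3]] := nearest0_Omega3 c0 d0 O3.
    case: ltP => sc; first by rewrite p1// ltW.
    by case: ltP => sd; [rewrite p2// ltW | rewrite p3].
  by have [/mem_set|/mem_set|/mem_set] :=
    Omega_cover d0 (le_trans s0 st) v0 hy.
move=> a0 b0 hx hs; rewrite /gamma1; case: leP => u0; first exact: nneg.
by rewrite nneg//; [rewrite nearest0N ?opprK//; lra | lra | lra].
Qed.

(** * The explicit value is an energy *)

Definition energy (R : realType) (t : R) (w : R -> R) : R :=
  1 / 2 * \int[@lebesgue_measure R]_(s in `[0, t]) w s ^+ 2.

Lemma continuous_sq_integrable (R : realType) (t : R) (f : R -> R) :
  {within `[0, t], continuous f} ->
  (@lebesgue_measure R).-integrable `[0, t] (EFin \o (fun s => f s ^+ 2)).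
Proof.
move=> cf; apply: continuous_compact_integrable; first exact: segment_compact.
by move=> s; apply: cvgM; exact: cf.
Qed.

Lemma Rintegral_split (R : realType) (p q r : R) (f : R -> R) :
  (@lebesgue_measure R).-integrable `[p, r] (EFin \o f) -> p <= q -> q <= r ->
  \int[@lebesgue_measure R]_(s in `[p, r]) f s =
  \int[@lebesgue_measure R]_(s in `[p, q]) f s +
  \int[@lebesgue_measure R]_(s in `[q, r]) f s.
Proof.
move=> intf pq qr.
rewrite -[X in _ + X]Rintegral_itv_obnd_cbnd; last first.
  apply: integrableS intf => //.
  by apply: subset_itvScc; rewrite bnd_simp.
by rewrite -(@Rintegral_itvB _ _ (BLeft p))// ?bnd_simp//; ring.
Qed.

(** The cube of the affine function divided by 3 m is a primitive. *)
Lemma Rintegral_affine_sq (R : realType) (p q k m : R) (f : R -> R) :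
  p <= q -> m != 0 -> (forall s, p <= s -> s <= q -> f s = k + m * s) ->
  \int[@lebesgue_measure R]_(s in `[p, q]) f s ^+ 2 =
    (f q ^+ 3 - f p ^+ 3) / (3 * m).
Proof.
move=> pq m0 fE; rewrite (fE q)// (fE p)//.
transitivity (\int[@lebesgue_measure R]_(s in `[p, q]) (k + m * s) ^+ 2).
  by apply: eq_Rintegral => s /set_mem /=; rewrite in_itv/= => /andP[ps sq]; rewrite fE.
move: pq; rewrite le_eqVlt => /predU1P[<-|pq].
  by rewrite set_itv1 Rintegral_set1 subrr mul0r.
pose G (s : R) := (k + m * s) ^+ 3 / (3 * m).
have dG (s : R) : is_derive s 1 G ((k + m * s) ^+ 2).
  apply: is_derive_eq.
  by rewrite /GRing.scale/=; field.
have cG : continuous G.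
  by move=> s; apply/differentiable_continuous/derivable1_diffP.
rewrite /Rintegral (@continuous_FTC2 _ _ G)//.
- by rewrite -EFinB/= /G; field.
- apply: continuous_subspaceT => s; apply: cvgM; apply: cvgD; try exact: cvg_cst;
  by apply: cvgM; [exact: cvg_cst | exact: cvg_id].
- split; [by move=> s _ | |].
  + by apply: cvg_at_right_filter; exact: cG.
  + by apply: cvg_at_left_filter; exact: cG.
- by move=> s _; rewrite derive1E derive_val.
Qed.

Lemma energyN (R : realType) (t : R) (f g : R -> R) :
  (forall s, 0 <= s <= t -> f s = - g s) -> energy t f = energy t g.
Proof.
move=> fg; congr (_ * _); apply: eq_Rintegral => s /set_mem /=.
by rewrite in_itv/= => /fg ->; rewrite sqrrN.
Qed.

(** The end points of the affine pieces are known from the region lemmas, so each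
    case of V is the sum of the energies of the moving pieces, the resting piece
    contributing nothing. *)
Lemma V1_energy (R : realType) (x t u a b : R) : 0 < a -> 0 < b -> 0 <= t ->
  u - b * t <= x <= u + a * t ->
  V1 x t u a b = (energy t (nearest0 x t u a b))%:E.
Proof.
move=> a0 b0 t0 hx.
have nneg y v c d : 0 < c -> 0 < d -> 0 <= v -> v - d * t <= y <= v + c * t ->
    V1_nneg y t v c d = (energy t (nearest0 y t v c d))%:E.
  move=> c0 d0 v0 hy; set f := nearest0 y t v c d.
  have intf : (@lebesgue_measure R).-integrable `[0, t]
      (EFin \o (fun s => f s ^+ 2)).
    apply/continuous_sq_integrable/(@slope_bounded_continuous _ c d); try lra.
    by apply: slope_bounded_nearest0; lra.
  have f0 : f 0 = v by exact: nearest0_start.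
  have ft : f t = y by exact: nearest0_end.
  have intS p q : 0 <= p -> q <= t -> (@lebesgue_measure R).-integrable `[p, q]
      (EFin \o (fun s => f s ^+ 2)).
    move=> p0 qt; apply: integrableS intf => //.
    by apply: subset_itvScc; rewrite bnd_simp.
  have p1E k : 0 <= k -> (forall s, 0 <= s -> s <= k -> f s = v - d * s) ->
      \int[@lebesgue_measure R]_(s in `[0, k]) f s ^+ 2 =
        (f k ^+ 3 - v ^+ 3) / (3 * - d).
    move=> k0 fE; rewrite -f0; apply: (@Rintegral_affine_sq _ _ _ v) => //.
      by lra.
    by move=> s s0 sk; rewrite fE//; ring.
  have p3E k m : k <= t -> m != 0 ->
      (forall s, k <= s -> s <= t -> f s = m * (s - t) + y) ->
      \int[@lebesgue_measure R]_(s in `[k, t]) f s ^+ 2 =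
        (y ^+ 3 - f k ^+ 3) / (3 * m).
    move=> kt m0 fE; rewrite -ft.
    apply: (@Rintegral_affine_sq _ _ _ (y - m * t)) => //.
    by move=> s s0 sk; rewrite fE//; ring.
  have p2E k l : k <= l -> (forall s, k <= s -> s <= l -> f s = 0) ->
      \int[@lebesgue_measure R]_(s in `[k, l]) f s ^+ 2 = 0.
    move=> kl fE.
    transitivity (\int[@lebesgue_measure R]_(s in `[k, l]) (0 : R)).
      apply: eq_Rintegral => s /set_mem /=; rewrite in_itv/= => /andP[ps sq].
      by rewrite fE// expr0n.
    by rewrite Rintegral_cst// mul0r.
  rewrite /V1_nneg /energy.
  case: ifPn => [/set_mem O1|/negP nO1].
    have [/andP[k0 kt] p1 p3 vE] := nearest0_Omega1 c0 d0 hy O1.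
    rewrite (Rintegral_split intf k0 kt) p1E// (p3E _ c)//; last by lra.
    rewrite -/f in p1 p3 *; rewrite p1// vE; congr EFin; field; lra.
  case: ifPn => [/set_mem O2|/negP nO2].
    have [[k0 kl lt] [p1 p2 p3]] := nearest0_Omega2 c0 d0 O2.
    rewrite (Rintegral_split intf (le_trans k0 kl) lt).
    rewrite (Rintegral_split (intS _ _ (lexx _) lt) k0 kl).
    rewrite p1E// p2E// (p3E _ c)//; last by lra.
    by rewrite -/f in p2 *; rewrite !p2//; congr EFin; field; lra.
  case: ifPn => [/set_mem O3|/negP nO3].
    have [[k0 kl lt] [p1 p2 p3]] := nearest0_Omega3 c0 d0 O3.
    rewrite (Rintegral_split intf (le_trans k0 kl) lt).
    rewrite (Rintegral_split (intS _ _ (lexx _) lt) k0 kl).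
    rewrite p1E// p2E// (p3E _ (- d))//; last by lra.
    by rewrite -/f in p2 *; rewrite !p2//; congr EFin; field; lra.
  by have [/mem_set|/mem_set|/mem_set] := Omega_cover d0 t0 v0 hy.
rewrite /V1; case: leP => u0; first exact: nneg.
rewrite nneg//; [congr EFin | lra | lra].
by apply: energyN => s hs; rewrite nearest0N//; lra.
Qed.

(** * Derivatives of the explicit curve *)

Lemma is_derive_affine (R : realType) (k m s : R) :
  is_derive s 1 (fun r : R => k + m * r) m.
Proof. by apply: is_derive_eq; rewrite /GRing.scale/=; ring. Qed.

Lemma is_derive_if_lt (R : realType) (c s : R) (f g : R -> R) (df dg : R) :
  s != c -> is_derive s 1 f df -> is_derive s 1 g dg ->
  is_derive s 1 (fun r => if r < c then f r else g r) (if s < c then df else dg).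
Proof.
move=> sc hf hg; case: ltP => h.
  apply: near_eq_is_derive hf; near=> r.
  by have -> : r < c by near: r; exact: lt_nbhsl.
have {}h : c < s by rewrite lt_neqAle eq_sym sc.
apply: near_eq_is_derive hg; near=> r.
by rewrite ltNge ltW//=; near: r; exact: lt_nbhsr.
Unshelve. all: by end_near. Qed.

(** The curve is piecewise affine with at most two break points c and d, and its
    slopes are among a, -b and 0. *)
Lemma gamma1_is_derive (R : realType) (x t u a b : R) : 0 < a -> 0 < b ->
  exists c d : R, forall s : R, s != c -> s != d ->
    exists2 m, - b <= m <= a & is_derive s 1 (fun r => gamma1 r x t u a b) m.
Proof.
have key (m0 k0 m1 k1 m2 k2 c d lo hi s : R) : lo <= m0 <= hi ->
    lo <= m1 <= hi -> lo <= m2 <= hi -> s != c -> s != d ->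
    exists2 m, lo <= m <= hi & is_derive s 1 (fun r => if r < c then k0 + m0 * r
      else if r < d then k1 + m1 * r else k2 + m2 * r) m.
  move=> h0 h1 h2 sc sd; exists (if s < c then m0 else if s < d then m1 else m2).
    by do 2?[case: ifP].
  do 2!(apply: is_derive_if_lt => //; first exact: is_derive_affine).
  exact: is_derive_affine.
have nneg y v e f : 0 < e -> 0 < f -> exists c d : R, forall s : R, s != c -> s != d ->
    exists2 m, - f <= m <= e & is_derive s 1 (fun r => gamma1_nneg r y t v e f) m.
  move=> e0 f0; rewrite /gamma1_nneg.
  case: (_ \in Omega1 e f).
    exists ((- y + v + e * t) / (e + f)), ((- y + v + e * t) / (e + f)).
    set c := _ / _ => s sc sd.
    have [|||m hm dm] := @key (- f) v 0 0 e (y - e * t) c c (- f) e s _ _ _ sc sd;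
      try lra.
    exists m => //; rewrite [X in is_derive _ _ X](_ : _ = (fun r => if r < c
      then v + - f * r else if r < c then 0 + 0 * r else y - e * t + e * r))//.
    by apply/funext => r; case: ltP => _; ring.
  case: (_ \in Omega2 e f).
    exists (v / f), (t - y / e); set c := _ / _; set d := _ - _ => s sc sd.
    have [|||m hm dm] := @key (- f) v 0 0 e (y - e * t) c d (- f) e s _ _ _ sc sd;
      try lra.
    exists m => //; rewrite [X in is_derive _ _ X](_ : _ = (fun r => if r < c
      then v + - f * r else if r < d then 0 + 0 * r else y - e * t + e * r))//.
    by apply/funext => r; case: ltP => _; [|case: ltP => _]; ring.
  case: (_ \in Omega3 e f).
    exists (v / f), (t - `|y| / f); set c := _ / _; set d := _ - _ => s sc sd.
    have [|||m hm dm] := @key (- f) v 0 0 (- f) (y + f * t) c d (- f) e s _ _ _ sc sd;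
      try lra.
    exists m => //; rewrite [X in is_derive _ _ X](_ : _ = (fun r => if r < c
      then v + - f * r else if r < d then 0 + 0 * r else y + f * t + - f * r))//.
    by apply/funext => r; case: ltP => _; [|case: ltP => _]; ring.
  exists 0, 0 => s _ _; exists 0; first by lra.
  exact: is_derive_cst.
move=> a0 b0; rewrite /gamma1; case: (0 <= u); first exact: nneg.
have [c [d hcd]] := nneg (- x) (- u) b a b0 a0.
exists c, d => s sc sd; have [m hm dm] := hcd s sc sd.
by exists (- m); [lra | exact: is_deriveN].
Qed.

(** * Minimizers of lower semicontinuous functions *)

(** The sublevel sets of the values of f on A form a filter base; any cluster
    point of it is a minimizer, since lower semicontinuity forbids a value above
    some f q at a cluster point of the sublevel set of f q. *)
Lemma lower_semicontinuous_compact_min (T : topologicalType) (R : realType)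
    (f : T -> R) (A : set T) :
  compact A -> A !=set0 ->
  (forall p c, A p -> c < f p -> \forall q \near p, c < f q) ->
  exists2 p, A p & forall q, A q -> f p <= f q.
Proof.
move=> cA [p0 Ap0] lsc.
pose F := filter_from A (fun y => [set q | A q /\ f q <= f y]).
have FF : ProperFilter F.
  apply: filter_from_proper; last by move=> y Ay; exists y.
  apply: filter_from_filter; first by exists p0.
  move=> y z Ay Az; have [yz|/ltW zy] := leP (f y) (f z).
    by exists y => // q [Aq qy]; split; split=> //; exact: le_trans yz.
  by exists z => // q [Aq qz]; split; split=> //; exact: le_trans zy.
have FA : F A by exists p0 => // q [].
have [p [Ap clp]] := cA F FF FA.
exists p => // y Ay; rewrite leNgt; apply/negP => yp.
have [|q [[_ qy]]] := clp [set q | A q /\ f q <= f y] _ _ (lsc p _ Ap yp).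
  by exists y.
by rewrite /= ltNge qy.
Qed.

(** The box is the image, under the continuous transposition, of a product of
    compact segments in the space of row vectors. *)
Lemma compact_cV_box (R : realType) (n : nat) (lo hi : 'cV[R]_n) :
  compact [set u : 'cV[R]_n | forall i, lo i 0 <= u i 0 <= hi i 0].
Proof.
have := @rV_compact R n (fun i => `[lo i 0, hi i 0]%classic)
  (fun i => @segment_compact _ _ _).
set B := mkset _ => cB.
have -> : [set u : 'cV[R]_n | forall i, lo i 0 <= u i 0 <= hi i 0] = trmx @` B.
  apply/seteqP; split => [u hu|_ [v Bv <-] i].
    by exists u^T; [move=> i; rewrite /= in_itv/= mxE | exact: trmxK].
  by have := Bv i; rewrite /= in_itv/= mxE.
apply: continuous_compact cB; apply: continuous_subspaceT.
move=> v A [/= P vP PA]; exists (fun i j => P j i) => [i j|w Pw].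
  by have := vP j i; rewrite mxE.
by apply: PA => i j; rewrite mxE.
Qed.

(** * Vector-valued trajectories *)

Lemma ae_lebesgue_imply (R : realType) (A B : R -> Prop) :
  {ae @lebesgue_measure R, forall s, A s} -> (forall s, A s -> B s) ->
  {ae @lebesgue_measure R, forall s, B s}.
Proof. by move=> hA AB; apply: negligibleS hA => s /= nB /AB. Qed.

Lemma cV_coord_le_norm (R : realType) (n : nat) (w : 'cV[R]_n) (i : 'I_n) :
  `|w i 0| <= `|w|.
Proof.
rewrite [leRHS]/Num.Def.normr/= mx_normrE.
exact: (le_bigmax _ (fun ij : 'I_n * 'I_1 => `|w ij.1 ij.2|) (i, 0)).
Qed.

Lemma cV_norm_le (R : realType) (n : nat) (w : 'cV[R]_n) (k : R) : 0 <= k ->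
  (forall i, `|w i 0| <= k) -> `|w| <= k.
Proof.
move=> k0 wk; rewrite [leLHS]/Num.Def.normr/= mx_normrE.
by apply: bigmax_le => // -[i j] _ /=; rewrite (ord1 j).
Qed.

Lemma mulmx_norm_le (R : realType) (n : nat) (B : 'M[R]_n) :
  exists2 K, 0 <= K & forall w : 'cV[R]_n, `|B *m w| <= K * `|w|.
Proof.
have K0 : 0 <= \sum_i \sum_j `|B i j| by do 2!apply: sumr_ge0 => ? _.
exists (\sum_i \sum_j `|B i j|) => // w; apply: cV_norm_le => [|i].
  by rewrite mulr_ge0.
rewrite mxE; apply: le_trans (ler_norm_sum _ _ _) _.
apply: (@le_trans _ _ ((\sum_j `|B i j|) * `|w|)).
  rewrite mulr_suml; apply: ler_sum => j _.
  by rewrite normrM ler_wpM2l// cV_coord_le_norm.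
rewrite ler_wpM2r// [leRHS](bigD1 i)//= lerDl.
by do 2!apply: sumr_ge0 => ? _.
Qed.

Lemma is_derive_scale_shift (R : realType) (f : R -> R) (k c s df : R) :
  is_derive s 1 f df -> is_derive s 1 (fun r => k * (f r - c)) (k * df).
Proof.
move=> hf; have -> : k * df = k *: (df - 0) by rewrite subr0.
exact: (is_deriveZ k (is_deriveB hf (is_derive_cst c s 1))).
Qed.

Lemma is_derive_mulmx_coord (R : realType) (n : nat) (B : 'M[R]_n) (v : 'cV[R]_n)
    (z : R -> 'cV[R]_n) (s : R) (i : 'I_n) : derivable z s 1 ->
  is_derive s 1 (fun r => (B *m (z r - v)) i 0) ((B *m derive1 z s) i 0).
Proof.
move=> dz.
have -> : (fun r => (B *m (z r - v)) i 0) =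
    \sum_j (fun r => B i j * (z r j 0 - v j 0)).
  apply/funext => r; rewrite fct_sumE mxE; apply: eq_bigr => j _.
  by rewrite !mxE.
rewrite mxE; apply: is_derive_sum => j.
rewrite derive1E derive_mx// mxE.
have dzj : is_derive s 1 (fun r => z r j 0) ('D_1 (fun r => z r j 0) s).
  by apply/derivableP; have /derivable_mxP := dz; exact.
exact: is_derive_scale_shift.
Qed.

Lemma derivable_mulmx (R : realType) (n : nat) (B : 'M[R]_n) (v : 'cV[R]_n)
    (z : R -> 'cV[R]_n) (s : R) :
  derivable z s 1 -> derivable (fun r => B *m z r + v) s 1.
Proof.
move=> dz; apply/derivable_mxP => i j; rewrite (ord1 j).
have [dBz _] := is_derive_scale_shift 1 (- v i 0) (is_derive_mulmx_coord B 0 i dz).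
have -> : (fun r => (B *m z r + v) i 0) =
    (fun r => 1 * ((B *m (z r - 0)) i 0 - - v i 0)) => //.
by apply/funext => r; rewrite subr0 mul1r opprK [LHS]mxE.
Qed.

(** This is the identity <z, P P^T z> = |P^T z|^2. *)
Lemma mxnorm_sqE (R : realType) (n : nat) (P : 'M[R]_n) (z : 'cV[R]_n) :
  mxnorm (P *m P^T) z ^+ 2 = \sum_i (P^T *m z) i 0 ^+ 2.
Proof.
have dotE : dotv z (P *m P^T *m z) = \sum_i (P^T *m z) i 0 ^+ 2.
  have -> : dotv z (P *m P^T *m z) = (z^T *m (P *m P^T *m z)) 0 0.
    by rewrite [RHS]mxE; apply: eq_bigr => i _; rewrite [z^T _ _]mxE.
  rewrite -mulmxA mulmxA -[z^T *m P]trmxK trmx_mul trmxK [LHS]mxE.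
  by apply: eq_bigr => i _; rewrite [(P^T *m z)^T _ _]mxE expr2.
by rewrite /mxnorm sqr_sqrtr dotE// sumr_ge0// => i _; exact: sqr_ge0.
Qed.

Lemma cost_energy (R : realType) (n : nat) (Phi : 'cV[R]_n -> R) (P : 'M[R]_n)
    (v0 : 'cV[R]_n) (t : R) (z : R -> 'cV[R]_n) :
  (forall i, {within `[0, t], continuous (fun s => (P^T *m (z s - v0)) i 0)}) ->
  cost Phi (P *m P^T) v0 t z =
    (\sum_i energy t (fun s => (P^T *m (z s - v0)) i 0) + Phi (z 0))%:E.
Proof.
move=> cz; rewrite /cost EFinD; congr (_ + _)%E.
pose f i s := (1 / 2 * ((P^T *m (z s - v0)) i 0) ^+ 2)%:E.
have intsq i := continuous_sq_integrable (cz i).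
have intf i : (@lebesgue_measure R).-integrable `[0, t] (f i).
  by apply: (integrableZl _ (1 / 2) (intsq i)).
transitivity (\int[@lebesgue_measure R]_(s in `[0%R, t]) \sum_i f i s)%E.
  apply: eq_integral => s _.
  by rewrite mxnorm_sqE mulr_sumr /f sumEFin.
rewrite integral_sum// -sumEFin; apply: eq_bigr => i _.
rewrite /energy -RintegralZl// /Rintegral fineK//.
by apply: integrable_fin_num => //; exact: intf.
Qed.

(** The coordinates of P^T (z - v0) are Lipschitz and have the coordinates of
    P^T z' as derivatives; the lower bound is the upper bound for the opposite
    function. *)
Lemma admissible_slope_bounded (R : realType) (n : nat) (P : 'M[R]_n)
    (a b v0 x : 'cV[R]_n) (t : R) (z : R -> 'cV[R]_n) (i : 'I_n) :
  admissible P a b x t z ->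
  slope_bounded (a i 0) (b i 0) t (fun s => (P^T *m (z s - v0)) i 0).
Proof.
move=> [lipz _ aez]; set f := fun s => _.
have [M M0 zM] := pinfty_ex_gt0 lipz.
have [K K0 hK] := mulmx_norm_le P^T.
have fK r s : 0 <= r -> r <= s -> s <= t -> `|f s - f r| <= K * M * (s - r).
  move=> r0 rs st.
  have -> : f s - f r = (P^T *m (z s - z r)) i 0.
    rewrite /f !mulmxBr !mxE; ring.
  apply: le_trans (cV_coord_le_norm _ _) _; apply: le_trans (hK _) _.
  rewrite -mulrA ler_wpM2l//.
  have /= := zM (s, r); rewrite [`|s - r|]ger0_norm ?subr_ge0//; apply.
  by split; rewrite /= in_itv/=; apply/andP; split => //; lra.
have df s : derivable z s 1 -> derivable f s 1 /\ derive1 f s = (P^T *m derive1 z s) i 0.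
  by move=> /(is_derive_mulmx_coord P^T v0 i) [dfs dE]; rewrite derive1E.
have KM0 : 0 <= K * M by rewrite mulr_ge0// ltW.
move=> r s r0 rs st; apply/andP; split.
  rewrite mulNr lerNl.
  have := @ae_derive1_le _ (fun s => - f s) (K * M) (b i 0) t KM0.
  rewrite opprB; have -> : f r - f s = - f s - - f r by ring.
  apply=> //.
    by move=> p q p0 pq qt; rewrite -opprD normrN; exact: fK.
  apply: (ae_lebesgue_imply aez) => p h /h [dz /(_ i)]; have [dfp dE] := df _ dz.
  rewrite -dE => /andP[lo _]; split; first exact: derivableN.
  by rewrite derive1E deriveN// -derive1E lerNl.
apply: (@ae_derive1_le _ f (K * M) (a i 0) t KM0) => //.
apply: (ae_lebesgue_imply aez) => p h /h [dz /(_ i)]; have [dfp dE] := df _ dz.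
by rewrite -dE => /andP[_].
Qed.

Lemma gamma_coord (R : realType) (n : nat) (P : 'M[R]_n) (a b v0 x : 'cV[R]_n)
    (t : R) (u : 'cV[R]_n) (s : R) (i : 'I_n) : P \in unitmx ->
  (P^T *m (gamma P a b v0 x t u s - v0)) i 0 =
    gamma1 s (ycoord P v0 x i 0) t (u i 0) (a i 0) (b i 0).
Proof. by move=> Pu; rewrite /gamma addrK mulKVmx ?unitmx_tr// mxE. Qed.

Lemma Vbox_ineq (R : realType) (n : nat) (P : 'M[R]_n) (a b v0 x : 'cV[R]_n)
    (t : R) (u : 'cV[R]_n) (i : 'I_n) : Vbox P a b v0 x t u ->
  u i 0 - b i 0 * t <= ycoord P v0 x i 0 <= u i 0 + a i 0 * t.
Proof. by move=> /(_ i); lra. Qed.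

(** Away from the finitely many break points of its coordinates the curve is
    differentiable with slopes in the right range.  Lipschitz continuity on [0, t]
    comes from the description as nearest curve. *)
Lemma gamma_admissible (R : realType) (n : nat) (P : 'M[R]_n)
    (a b v0 x : 'cV[R]_n) (t : R) (u : 'cV[R]_n) :
  (forall i, 0 < a i 0) -> (forall i, 0 < b i 0) -> P \in unitmx -> 0 < t ->
  Vbox P a b v0 x t u -> admissible P a b x t (gamma P a b v0 x t u).
Proof.
move=> a0 b0 Pu t0 ubox; have PTu : P^T \in unitmx by rewrite unitmx_tr.
set z := gamma P a b v0 x t u.
pose g i s := gamma1 s (ycoord P v0 x i 0) t (u i 0) (a i 0) (b i 0).
have gE i s : 0 <= s <= t ->
    g i s = nearest0 (ycoord P v0 x i 0) t (u i 0) (a i 0) (b i 0) s.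
  by move=> hs; apply: gamma1_nearest0 => //; exact: Vbox_ineq.
split.
- have [K K0 hK] := mulmx_norm_le (invmx P^T).
  pose C := \sum_i (a i 0 + b i 0).
  have ab0 i : 0 <= a i 0 + b i 0 by rewrite ltW// addr_gt0.
  have C0 : 0 <= C by exact: sumr_ge0.
  apply: (@klipschitzW _ _ _ (K * C)).
    by apply: (@globally_properfilter _ _ (0, 0)); split; rewrite /= in_itv/= lexx ltW.
  move=> [s r] /= [] /=; rewrite !in_itv/= => hs hr.
  rewrite /z /gamma opprD addrACA subrr addr0 -mulmxBr; apply: le_trans (hK _) _.
  rewrite -mulrA ler_wpM2l//; apply: cV_norm_le => [|i]; first by rewrite mulr_ge0.
  rewrite mxE [X in X + _]mxE [X in _ + X]mxE [X in - X]mxE.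
  rewrite -/(g i s) -/(g i r) !gE//.
  apply: (@le_trans _ _ ((a i 0 + b i 0) * `|s - r|)).
    apply: slope_bounded_lipschitz hs hr; try exact: ltW.
    by apply: slope_bounded_nearest0; exact: ltW.
  by rewrite ler_wpM2r// /C (bigD1 i)//= lerDl sumr_ge0.
- apply: (can_inj (mulKmx PTu)); rewrite /z /gamma mulmxDr mulKVmx//.
  apply/colP => i; rewrite mxE mxE -/(g i t) gE ?lexx ?ltW//.
  by rewrite nearest0_end ?Vbox_ineq// /ycoord [X in X + _]mxE [X in _ + X + _]mxE subrK.
have gd i : {ae @lebesgue_measure R, forall s : R,
    exists2 m, - b i 0 <= m <= a i 0 & is_derive s 1 (g i) m}.
  have [c [d hcd]] := @gamma1_is_derive _ (ycoord P v0 x i 0) t (u i 0) _ _ (a0 i) (b0 i).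
  exists ([set c] `|` [set d]); split.
  - exact: measurableU.
  - by apply: null_set_setU => //; exact: lebesgue_measure_set1.
  - move=> s /= ns; apply: contrapT => ncd; apply: ns.
    by (apply: hcd; apply/eqP => e; apply: ncd); [left|right].
have : {ae @lebesgue_measure R, forall (s : R) i,
    exists2 m, - b i 0 <= m <= a i 0 & is_derive s 1 (g i) m}.
  apply: (@filter_forall _ _ _ _ (ae_filter_ringOfSetsType (@lebesgue_measure R))).
  exact: gd.
move=> gae; apply: (ae_lebesgue_imply gae) => s gs _.
have dz : derivable z s 1.
  apply: derivable_mulmx; apply/derivable_mxP => i j; under eq_fun do rewrite mxE.
  by have [m _ [dg _]] := gs i.
split => // i; have [m hm [_ dgE]] := gs i.
have [_ <-] := is_derive_mulmx_coord P^T v0 i dz.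
by under eq_fun do rewrite gamma_coord//; rewrite dgE.
Qed.

(** * Continuity and strict convexity of the energy *)

Lemma le_energy (R : realType) (t : R) (f g : R -> R) :
  {within `[0, t], continuous f} -> {within `[0, t], continuous g} ->
  (forall s, 0 <= s <= t -> f s ^+ 2 <= g s ^+ 2) -> energy t f <= energy t g.
Proof.
move=> cf cg fg; apply: ler_wpM2l; first by lra.
apply: le_Rintegral => //; exact: continuous_sq_integrable.
Qed.

(** Pointwise, f^2 + g^2 = 2 ((f + g) / 2)^2 + (f - g)^2 / 2. *)
Lemma energy_parallelogram (R : realType) (t : R) (f g : R -> R) :
  {within `[0, t], continuous f} -> {within `[0, t], continuous g} ->
  energy t f + energy t g =
    2 * energy t (fun s => (f s + g s) / 2) + 1 / 2 * energy t (fun s => f s - g s).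
Proof.
move=> cf cg.
have cm : {within `[0, t], continuous (fun s => (f s + g s) / 2)}.
  by move=> s; apply: cvgM; [apply: cvgD; [exact: cf|exact: cg] | exact: cvg_cst].
have cd : {within `[0, t], continuous (fun s => f s - g s)}.
  by move=> s; apply: cvgB; [exact: cf|exact: cg].
have intf := continuous_sq_integrable cf.
have intg := continuous_sq_integrable cg.
have intm := continuous_sq_integrable cm.
have intd := continuous_sq_integrable cd.
rewrite /energy -mulrDr -RintegralD//.
transitivity (1 / 2 * \int[@lebesgue_measure R]_(s in `[0, t])
  (2 * ((f s + g s) / 2) ^+ 2 + 1 / 2 * (f s - g s) ^+ 2)).
  by congr (_ * _); apply: eq_Rintegral => s _; field.
rewrite RintegralD//.
- by rewrite !RintegralZl//; ring.
- by apply: (integrableZl _ 2 intm).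
- by apply: (integrableZl _ (1 / 2) intd).
Qed.

Lemma energy_ge0 (R : realType) (t : R) (f : R -> R) : 0 <= energy t f.
Proof.
apply: mulr_ge0; first by lra.
by apply: Rintegral_ge0 => s _; exact: sqr_ge0.
Qed.

(** If f s <> 0, then |f| >= |f s| / 2 on an interval of positive length r inside
    [0, t], because f is Lipschitz, and this interval alone contributes a positive
    amount to the energy. *)
Lemma slope_bounded_energy_eq0 (R : realType) (a b t : R) (f : R -> R) :
  0 <= a -> 0 <= b -> 0 < t -> slope_bounded a b t f -> energy t f <= 0 ->
  forall s, 0 <= s <= t -> f s = 0.
Proof.
move=> a0 b0 t0 hf ef s hs; apply: contrapT => /eqP fs0.
have d0 : 0 < `|f s| by rewrite normr_gt0.
set d := `|f s| in d0.
pose r := Num.min (t / 2) (d / (2 * (a + b + 1))).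
have r0 : 0 < r by rewrite lt_min !divr_gt0//; lra.
have rt : r <= t / 2 by rewrite ge_min lexx.
have rd : (a + b) * r <= d / 2.
  have : (a + b + 1) * r <= (a + b + 1) * (d / (2 * (a + b + 1))).
    by rewrite ler_wpM2l ?ge_min ?lexx ?orbT//; lra.
  have -> : (a + b + 1) * (d / (2 * (a + b + 1))) = d / 2 by field; lra.
  lra.
(* The interval [p, p + r] starts or ends at s, whichever keeps it in [0, t]. *)
pose p := if s <= t / 2 then s else s - r.
have p0 : 0 <= p by rewrite /p; case: (leP s) => ?; lra.
have prt : p + r <= t by rewrite /p; case: (leP s) => ?; lra.
have intf := continuous_sq_integrable (slope_bounded_continuous a0 b0 hf).
have big q : p <= q -> q <= p + r -> (d / 2) ^+ 2 <= f q ^+ 2.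
  move=> pq qr; rewrite -[leRHS]real_normK ?num_real//.
  apply: lerXn2r; rewrite ?nnegrE//; first by lra.
  have := slope_bounded_lipschitz a0 b0 hf hs (_ : 0 <= q <= t).
  move=> /(_ ltac:(lra)) => hl.
  have : `|s - q| <= r by rewrite ler_norml; move: pq qr; rewrite /p; case: (leP s) => ?; lra.
  move=> /(ler_wpM2l (_ : 0 <= a + b)) => /(_ ltac:(lra)) => hr.
  have := ler_normD (f q) (f s - f q); rewrite addrC subrK -/d.
  by lra.
suff : (d / 2) ^+ 2 * r <= 0 by rewrite leNgt mulr_gt0// exprn_gt0// divr_gt0.
have int1 : (@lebesgue_measure R).-integrable `[p, p + r] (EFin \o (fun s => f s ^+ 2)).
  by apply: integrableS intf => //; apply: subset_itvScc; rewrite bnd_simp.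
apply: (@le_trans _ _ (\int[@lebesgue_measure R]_(q in `[p, p + r]) f q ^+ 2)).
  have -> : (d / 2) ^+ 2 * r =
      \int[@lebesgue_measure R]_(q in `[p, p + r]) (d / 2) ^+ 2.
    rewrite Rintegral_cst//= lebesgue_measure_itv/= lte_fin ltrDl r0 -EFinD/=.
    by congr (_ * _); ring.
  apply: le_Rintegral => //.
    apply: continuous_compact_integrable; first exact: segment_compact.
    by move=> q; exact: cvg_cst.
  by move=> q /=; rewrite in_itv/= => /andP[]; exact: big.
apply: (@le_trans _ _ (2 * energy t f)); last by lra.
rewrite /energy mulrA (_ : 2 * (1 / 2) = 1 :> R) ?mul1r; last by field.
rewrite (Rintegral_split intf p0)//; last by lra.
have int2 : (@lebesgue_measure R).-integrable `[p, t] (EFin \o (fun s => f s ^+ 2)).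
  by apply: integrableS intf => //; apply: subset_itvScc; rewrite bnd_simp.
rewrite (@Rintegral_split _ p (p + r))//; last by lra.
have ge0 A : 0 <= \int[@lebesgue_measure R]_(q in A) f q ^+ 2.
  by apply: Rintegral_ge0 => q _; exact: sqr_ge0.
by rewrite addrCA lerDl addr_ge0.
Qed.

Lemma nearest0_continuous (R : realType) (x t u a b : R) : 0 <= a -> 0 <= b ->
  {within `[0, t], continuous (nearest0 x t u a b)}.
Proof.
by move=> a0 b0; apply: (slope_bounded_continuous a0 b0);
   exact: slope_bounded_nearest0.
Qed.

(** A difference of squares is the product of a difference, at most |u - v|, with
    a sum that is bounded for v near u. *)
Lemma energy_nearest0_continuous (R : realType) (x t a b : R) :
  0 <= a -> 0 <= b -> 0 <= t ->
  continuous (fun u => energy t (nearest0 x t u a b)).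
Proof.
move=> a0 b0 t0 u.
(* M bounds the curve for u on [0, t]; by [nearest0_dist] the curve for v is
   bounded by M + 1 when |u - v| <= 1. *)
pose M := `|nearest0 x t u a b 0| + (a + b) * t.
have abt : 0 <= (a + b) * t by rewrite mulr_ge0// addr_ge0.
have M0 : 0 <= M by rewrite addr_ge0.
have uM s : 0 <= s <= t -> `|nearest0 x t u a b s| <= M.
  move=> hs; have h0 : (0 : R) <= 0 <= t by rewrite lexx.
  have := slope_bounded_lipschitz a0 b0 (@slope_bounded_nearest0 _ x t u a b a0 b0) h0 hs.
  rewrite sub0r normrN (ger0_norm (_ : 0 <= s)); last by lra.
  have : (a + b) * s <= (a + b) * t by rewrite ler_wpM2l//; lra.
  have := ler_normB (nearest0 x t u a b 0)
    (nearest0 x t u a b 0 - nearest0 x t u a b s).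
  by rewrite opprB addrC subrK /M; lra.
pose C := t * (2 * M + 1).
have C0 : 0 <= C by rewrite mulr_ge0//; lra.
have key v : `|u - v| <= 1 ->
    `|energy t (nearest0 x t u a b) - energy t (nearest0 x t v a b)| <= C * `|u - v|.
  move=> uv1.
  have intu := continuous_sq_integrable (@nearest0_continuous _ x t u a b a0 b0).
  have intv := continuous_sq_integrable (@nearest0_continuous _ x t v a b a0 b0).
  rewrite /energy -mulrBr -RintegralB// normrM ger0_norm; last by lra.
  apply: (@le_trans _ _ (`|\int[@lebesgue_measure R]_(s in `[0, t])
      (nearest0 x t u a b s ^+ 2 - nearest0 x t v a b s ^+ 2)|)).
    by rewrite ler_piMl//; lra.
  have intd : (@lebesgue_measure R).-integrable `[0, t] (EFin \o (fun s =>
      nearest0 x t u a b s ^+ 2 - nearest0 x t v a b s ^+ 2)).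
    by apply: (integrableB _ intu intv).
  apply: le_trans (le_normr_Rintegral _ _) _ => //.
  have -> : C * `|u - v| = \int[@lebesgue_measure R]_(s in `[0, t])
      ((2 * M + 1) * `|u - v|).
    rewrite Rintegral_cst//= lebesgue_measure_itv/= lte_fin /C.
    by case: ltP => [_|t0']; rewrite ?oppr0 ?adde0 ?subr0/=; [ring|
      have -> : t = 0 by lra]; ring.
  apply: le_Rintegral => //.
  - exact: integrable_norm.
  - apply: continuous_compact_integrable; first exact: segment_compact.
    by move=> q; exact: cvg_cst.
  move=> s /=; rewrite in_itv/= => hs.
  rewrite subr_sqr normrM mulrC ler_pM//; last exact: nearest0_dist.
  have := uM s hs; have := nearest0_dist x t u v a b s.
  set f := nearest0 x t u a b s; set g := nearest0 x t v a b s => fg fM.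
  have -> : f + g = 2 * f - (f - g) by ring.
  apply: le_trans (ler_normB _ _) _.
  by rewrite normrM (ger0_norm (_ : 0 <= 2)); lra.
apply/cvgrPdist_lt => e e0; exists (Num.min 1 (e / (C + 1))) => [/=|v /=].
  by rewrite lt_min ltr01 divr_gt0//; lra.
rewrite lt_min => /andP[uv1 uve].
apply: le_lt_trans (key v (ltW uv1)) _.
move: uve; rewrite ltr_pdivlMr; last by lra.
apply: le_lt_trans; rewrite mulrC ler_wpM2l//; lra.
Qed.

(** * The decoupled problem *)

Definition feasible (R : realType) (n : nat) (a b y : 'cV[R]_n) (t : R)
    (W : R -> 'cV[R]_n) : Prop :=
  W t = y /\ forall i, slope_bounded (a i 0) (b i 0) t (fun s => W s i 0).

(** The cost in terms of the curve W = P^T (z - v0). *)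
Definition reduced_cost (R : realType) (n : nat) (Phi : 'cV[R]_n -> R)
    (P : 'M[R]_n) (v0 : 'cV[R]_n) (t : R) (W : R -> 'cV[R]_n) : R :=
  \sum_i energy t (fun s => W s i 0) + Phi (invmx P^T *m W 0 + v0).

Definition nearest_curve (R : realType) (n : nat) (a b y : 'cV[R]_n) (t : R)
    (u : 'cV[R]_n) (s : R) : 'cV[R]_n :=
  \col_i nearest0 (y i 0) t (u i 0) (a i 0) (b i 0) s.

Lemma eq_energy (R : realType) (t : R) (f g : R -> R) :
  (forall s, 0 <= s <= t -> f s = g s) -> energy t f = energy t g.
Proof.
move=> fg; congr (_ * _); apply: eq_Rintegral => s /set_mem /=.
by rewrite in_itv/= => /fg ->.
Qed.

Lemma ycoordE (R : realType) (n : nat) (P : 'M[R]_n) (v0 x : 'cV[R]_n) :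
  ycoord P v0 x = P^T *m (x - v0).
Proof. by rewrite /ycoord mulmxBr. Qed.

Lemma feasible_nearest_curve (R : realType) (n : nat) (P : 'M[R]_n)
    (a b v0 x : 'cV[R]_n) (t : R) (u : 'cV[R]_n) :
  (forall i, 0 < a i 0) -> (forall i, 0 < b i 0) -> Vbox P a b v0 x t u ->
  feasible a b (ycoord P v0 x) t (nearest_curve a b (ycoord P v0 x) t u) /\
  nearest_curve a b (ycoord P v0 x) t u 0 = u.
Proof.
move=> a0 b0 ubox; split.
  split=> [|i].
    by apply/colP => i; rewrite [LHS]mxE nearest0_end//; exact: Vbox_ineq.
  rewrite (_ : (fun s => _) = nearest0 (ycoord P v0 x i 0) t (u i 0) (a i 0) (b i 0)).
    by apply: slope_bounded_nearest0; exact: ltW.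
  by apply/funext => s; rewrite mxE.
by apply/colP => i; rewrite [LHS]mxE nearest0_start//; exact: Vbox_ineq.
Qed.

Lemma feasible_continuous (R : realType) (n : nat) (a b y : 'cV[R]_n) (t : R)
    (W : R -> 'cV[R]_n) (i : 'I_n) :
  (forall i, 0 < a i 0) -> (forall i, 0 < b i 0) -> feasible a b y t W ->
  {within `[0, t], continuous (fun s => W s i 0)}.
Proof.
by move=> a0 b0 [_ hW]; apply: slope_bounded_continuous (hW i); exact: ltW.
Qed.

Lemma feasible_Vbox (R : realType) (n : nat) (P : 'M[R]_n) (a b v0 x : 'cV[R]_n)
    (t : R) (W : R -> 'cV[R]_n) : 0 <= t ->
  feasible a b (ycoord P v0 x) t W -> Vbox P a b v0 x t (W 0).
Proof.
move=> t0 [Wt hW] i; rewrite -Wt.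
have := hW i 0 t (lexx _) t0 (lexx _); lra.
Qed.

(** Among feasible curves with the same starting point the nearest curve is
    cheapest, coordinate by coordinate; the Phi terms coincide. *)
Lemma nearest_curve_optimal (R : realType) (n : nat) (Phi : 'cV[R]_n -> R)
    (P : 'M[R]_n) (a b v0 x : 'cV[R]_n) (t : R) (W : R -> 'cV[R]_n) :
  (forall i, 0 < a i 0) -> (forall i, 0 < b i 0) -> 0 <= t ->
  feasible a b (ycoord P v0 x) t W ->
  reduced_cost Phi P v0 t (nearest_curve a b (ycoord P v0 x) t (W 0)) <=
    reduced_cost Phi P v0 t W.
Proof.
move=> a0 b0 t0 fW; have Wbox := feasible_Vbox t0 fW.
have [fN N0] := feasible_nearest_curve a0 b0 Wbox.
rewrite /reduced_cost N0 lerD2r; apply: ler_sum => i _; apply: le_energy.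
- exact: feasible_continuous fN.
- exact: feasible_continuous fW.
- move=> s hs; rewrite [X in X ^+ 2 <= _]mxE -(proj1 fW).
  by have := nearest0_minimal (proj2 fW i) hs.
Qed.

Lemma Vobj_reduced_cost (R : realType) (n : nat) (Phi : 'cV[R]_n -> R)
    (P : 'M[R]_n) (a b v0 x : 'cV[R]_n) (t : R) (u : 'cV[R]_n) :
  (forall i, 0 < a i 0) -> (forall i, 0 < b i 0) -> 0 <= t ->
  Vbox P a b v0 x t u ->
  Vobj Phi P a b v0 x t u =
    (reduced_cost Phi P v0 t (nearest_curve a b (ycoord P v0 x) t u))%:E.
Proof.
move=> a0 b0 t0 ubox; have [_ N0] := feasible_nearest_curve a0 b0 ubox.
rewrite /Vobj /reduced_cost N0 EFinD -sumEFin; congr (_ + _)%E.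
apply: eq_bigr => i _; rewrite V1_energy//; last exact: Vbox_ineq.
by congr EFin; apply: eq_energy => s _; rewrite [RHS]mxE.
Qed.

Lemma admissible_feasible (R : realType) (n : nat) (Phi : 'cV[R]_n -> R)
    (P : 'M[R]_n) (a b v0 x : 'cV[R]_n) (t : R) (z : R -> 'cV[R]_n) :
  (forall i, 0 < a i 0) -> (forall i, 0 < b i 0) -> P \in unitmx ->
  admissible P a b x t z ->
  feasible a b (ycoord P v0 x) t (fun s => P^T *m (z s - v0)) /\
  cost Phi (P *m P^T) v0 t z =
    (reduced_cost Phi P v0 t (fun s => P^T *m (z s - v0)))%:E.
Proof.
move=> a0 b0 Pu az.
have fz : feasible a b (ycoord P v0 x) t (fun s => P^T *m (z s - v0)).
  split=> [|i]; last exact: admissible_slope_bounded az.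
  by case: az => _ -> _; rewrite ycoordE.
split=> //; rewrite cost_energy => [|i].
  by rewrite /reduced_cost mulKmx ?unitmx_tr// subrK.
exact: feasible_continuous fz.
Qed.

Lemma gamma_nearest_curve (R : realType) (n : nat) (P : 'M[R]_n)
    (a b v0 x : 'cV[R]_n) (t : R) (u : 'cV[R]_n) (s : R) :
  (forall i, 0 < a i 0) -> (forall i, 0 < b i 0) -> P \in unitmx ->
  Vbox P a b v0 x t u -> 0 <= s <= t ->
  P^T *m (gamma P a b v0 x t u s - v0) = nearest_curve a b (ycoord P v0 x) t u s.
Proof.
move=> a0 b0 Pu ubox hs; apply/colP => i; rewrite gamma_coord// [RHS]mxE.
by rewrite gamma1_nearest0//; exact: Vbox_ineq.
Qed.

Lemma cost_gamma (R : realType) (n : nat) (Phi : 'cV[R]_n -> R)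
    (P : 'M[R]_n) (a b v0 x : 'cV[R]_n) (t : R) (u : 'cV[R]_n) :
  (forall i, 0 < a i 0) -> (forall i, 0 < b i 0) -> P \in unitmx -> 0 < t ->
  Vbox P a b v0 x t u ->
  cost Phi (P *m P^T) v0 t (gamma P a b v0 x t u) = Vobj Phi P a b v0 x t u.
Proof.
move=> a0 b0 Pu t0 ubox; have t0' := ltW t0.
have [_ ->] := admissible_feasible Phi v0 a0 b0 Pu
  (@gamma_admissible _ _ P a b v0 x t u a0 b0 Pu t0 ubox).
rewrite Vobj_reduced_cost//; congr EFin.
rewrite /reduced_cost gamma_nearest_curve ?lexx//; congr (_ + _).
apply: eq_bigr => i _; apply: eq_energy => s hs.
by rewrite gamma_nearest_curve.
Qed.

(** On the compact box the objective is a continuous function of u plus the lower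
    semicontinuous Phi composed with an affine map. *)
Lemma Vminimizer_exists (R : realType) (n : nat) (Phi : 'cV[R]_n -> R)
    (P : 'M[R]_n) (a b v0 x : 'cV[R]_n) (t : R) :
  lower_semicontinuous (fun z : 'cV[R]_n => (Phi z)%:E) ->
  (forall i, 0 < a i 0) -> (forall i, 0 < b i 0) -> 0 <= t ->
  exists u, Vminimizer Phi P a b v0 x t u.
Proof.
move=> lscPhi a0 b0 t0; set y := ycoord P v0 x.
pose E (u : 'cV[R]_n) := \sum_i energy t (nearest0 (y i 0) t (u i 0) (a i 0) (b i 0)).
pose obj (u : 'cV[R]_n) := E u + Phi (invmx P^T *m u + v0).
have VobjE u : Vbox P a b v0 x t u -> Vobj Phi P a b v0 x t u = (obj u)%:E.
  move=> ubox; have [_ N0] := feasible_nearest_curve a0 b0 ubox.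
  rewrite Vobj_reduced_cost// /reduced_cost N0; congr (_ + _)%:E.
  by apply: eq_bigr => i _; apply: eq_energy => s _; rewrite [LHS]mxE.
have cE : continuous E.
  have cEi i : continuous (fun u : 'cV[R]_n =>
      energy t (nearest0 (y i 0) t (u i 0) (a i 0) (b i 0))).
    move=> u; apply: (@continuous_comp _ _ _ (fun u : 'cV[R]_n => u i 0)
      (fun r => energy t (nearest0 (y i 0) t r (a i 0) (b i 0)))).
      exact: coord_continuous.
    by apply: energy_nearest0_continuous => //; exact: ltW.
  move=> u; apply: (@cvg_big _ _ _ _ _ add_continuous _ (nbhs u) _ _ _
    (nbhs_filter u)) => i _.
  exact: cEi.
have cA (p : 'cV[R]_n) U : nbhs (invmx P^T *m p + v0) U ->
    \forall q \near p, U (invmx P^T *m q + v0).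
  have [K K0 hK] := mulmx_norm_le (invmx P^T).
  move=> /nbhs_ballP[e /= e0 eU]; apply/nbhs_ballP.
  exists (e / (K + 1)) => [/=|q]; first by rewrite divr_gt0//; lra.
  rewrite mx_norm_ball /ball_/= ltr_pdivlMr; last by lra.
  move=> pq; apply: eU; rewrite mx_norm_ball /ball_/=.
  rewrite opprD addrACA subrr addr0 -mulmxBr.
  apply: le_lt_trans (hK _) _; apply: le_lt_trans pq.
  by rewrite mulrC ler_wpM2l//; lra.
have [||p c _ cp|p pbox pmin] :=
    @lower_semicontinuous_compact_min _ R obj (Vbox P a b v0 x t).
- rewrite (_ : Vbox P a b v0 x t = [set u | forall i,
      (\col_i (y i 0 - a i 0 * t)) i 0 <= u i 0 <= (\col_i (y i 0 + b i 0 * t)) i 0]).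
    exact: compact_cV_box.
  by apply/seteqP; split=> u hu i; have := hu i; rewrite !mxE.
- exists y => i; have := a0 i; have := b0 i => bi ai.
  have : 0 <= a i 0 * t by rewrite mulr_ge0// ltW.
  have : 0 <= b i 0 * t by rewrite mulr_ge0// ltW.
  rewrite -/y; lra.
- pose d := (obj p - c) / 2.
  have d0 : 0 < d by rewrite divr_gt0// subr_gt0.
  have [] := lscPhi (invmx P^T *m p + v0) (Phi (invmx P^T *m p + v0) - d).
    by rewrite lte_fin; lra.
  move=> U nU hU; have nA := cA p U nU.
  have nE : \forall q \near p, `|E p - E q| < d by move/cvgrPdist_lt: (cE p); apply.
  apply: (@filterS2 _ _ (nbhs_filter p) _ _ _ _ nE nA) => q; rewrite ltr_distlC => /andP[Eq _] /= /hU.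
  rewrite lte_fin /obj; move: Eq; rewrite /d /obj; lra.
exists p; split => // w wbox.
by rewrite !VobjE// lee_fin; exact: pmin.
Qed.

Lemma convex_midpoint (R : realType) (n : nat) (Phi : 'cV[R]_n -> R)
    (p q : 'cV[R]_n) : convex_function [set: convex_lmodType 'cV[R]_n] Phi ->
  Phi (2^-1 *: (p + q)) <= (Phi p + Phi q) / 2.
Proof.
move=> cPhi; have h01 : 0 <= (2^-1 : R) <= 1 by lra.
have /andP[h0 h1] := h01.
have := cPhi (@Itv01 R 2^-1 h0 h1) p q; rewrite !inE => /(_ I I).
have -> : @conv R (convex_lmodType 'cV[R]_n) (@Itv01 R 2^-1 h0 h1) p q =
    2^-1 *: (p + q).
  by rewrite /conv/= /unstable.onem scalerDr; congr (_ + _ *: _); field.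
by rewrite convRE/= /unstable.onem; lra.
Qed.

(** * Uniqueness under convexity *)

Lemma feasible_midpoint (R : realType) (n : nat) (a b y : 'cV[R]_n) (t : R)
    (W G : R -> 'cV[R]_n) : feasible a b y t W -> feasible a b y t G ->
  feasible a b y t (fun s => 2^-1 *: (W s + G s)).
Proof.
move=> [Wt hW] [Gt hG]; split=> [|i].
  by rewrite Wt Gt -mulr2n -[y *+ 2]scaler_nat scalerA mulVf ?scale1r// pnatr_eq0.
rewrite (_ : (fun s => _) = (fun s => (W s i 0 + G s i 0) / 2)).
  exact: slope_bounded_midpoint.
by apply/funext => s; rewrite mxE mxE mulrC.
Qed.

(** Strict convexity in quantitative form: the deficit of the midpoint controls
    the energy of the difference. *)
Lemma reduced_cost_midpoint (R : realType) (n : nat) (Phi : 'cV[R]_n -> R)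
    (P : 'M[R]_n) (a b v0 y : 'cV[R]_n) (t : R) (W G : R -> 'cV[R]_n) :
  (forall i, 0 < a i 0) -> (forall i, 0 < b i 0) ->
  convex_function [set: convex_lmodType 'cV[R]_n] Phi ->
  feasible a b y t W -> feasible a b y t G ->
  2 * reduced_cost Phi P v0 t (fun s => 2^-1 *: (W s + G s)) +
    1 / 2 * \sum_i energy t (fun s => W s i 0 - G s i 0) <=
  reduced_cost Phi P v0 t W + reduced_cost Phi P v0 t G.
Proof.
move=> a0 b0 cPhi fW fG; rewrite /reduced_cost addrACA -big_split/=.
have -> : \sum_i (energy t (fun s => W s i 0) + energy t (fun s => G s i 0)) =
    2 * \sum_i energy t (fun s => (2^-1 *: (W s + G s)) i 0) +
    1 / 2 * \sum_i energy t (fun s => W s i 0 - G s i 0).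
  rewrite !mulr_sumr -big_split/=; apply: eq_bigr => i _.
  rewrite energy_parallelogram; [|exact: feasible_continuous fW|
    exact: feasible_continuous fG].
  congr (2 * _ + _); apply: eq_energy => s _.
  by rewrite [RHS]mxE [X in _ = _ * X]mxE mulrC.
have := convex_midpoint (invmx P^T *m W 0 + v0) (invmx P^T *m G 0 + v0) cPhi.
have -> : 2^-1 *: (invmx P^T *m W 0 + v0 + (invmx P^T *m G 0 + v0)) =
    invmx P^T *m (2^-1 *: (W 0 + G 0)) + v0.
  rewrite addrACA -mulmxDr scalerDr -scalemxAr; congr (_ + _).
  by rewrite -mulr2n -[v0 *+ 2]scaler_nat scalerA mulVf ?scale1r// pnatr_eq0.
lra.
Qed.

Theorem proposition5 (R : realType) (n : nat) (Phi : 'cV[R]_n -> R)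
    (Phi_lsc : lower_semicontinuous (fun z : 'cV[R]_n => (Phi z)%:E))
    (a b : 'cV[R]_n)
    (a_gt0 : forall i, 0 < a i 0) (b_gt0 : forall i, 0 < b i 0)
    (v0 : 'cV[R]_n) (P : 'M[R]_n) (P_unit : P \in unitmx)
    (x : 'cV[R]_n) (t : R) (t_gt0 : 0 < t) :
  [/\ optimal_value Phi P a b v0 x t = Vfun Phi P a b v0 x t,
      exists u, Vminimizer Phi P a b v0 x t u &
      forall u, Vminimizer Phi P a b v0 x t u ->
        optimal_trajectory Phi P a b v0 x t (gamma P a b v0 x t u) /\
        (convex_function [set: convex_lmodType 'cV[R]_n] Phi ->
         forall z, optimal_trajectory Phi P a b v0 x t z ->
           forall s, 0 <= s <= t -> z s = gamma P a b v0 x t u s)].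
Proof.
have t_ge0 := ltW t_gt0; have PT_unit : P^T \in unitmx by rewrite unitmx_tr.
pose y := ycoord P v0 x.
(* Stated for feasible curves, not only for admissible trajectories, so that it
   also applies to a midpoint. *)
have feasible_ge W : feasible a b y t W ->
    exists2 u, Vbox P a b v0 x t u &
      (Vobj Phi P a b v0 x t u <= (reduced_cost Phi P v0 t W)%:E)%E.
  move=> fW; exists (W 0); first exact: feasible_Vbox fW.
  rewrite Vobj_reduced_cost ?lee_fin//; last exact: feasible_Vbox fW.
  exact: nearest_curve_optimal.
have cost_ge z : admissible P a b x t z ->
    exists2 u, Vbox P a b v0 x t u &
      (Vobj Phi P a b v0 x t u <= cost Phi (P *m P^T) v0 t z)%E.
  by move=> /(admissible_feasible Phi v0 a_gt0 b_gt0 P_unit)[/feasible_ge ? ->].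
split.
- apply/le_anti/andP; split.
    apply: le_ereal_inf_tmp => _ [u ubox <-]; apply: ereal_inf_lbound.
    exists (gamma P a b v0 x t u); first exact: gamma_admissible.
    exact: cost_gamma.
  apply: le_ereal_inf_tmp => _ [z az <-]; have [u ubox uz] := cost_ge z az.
  by apply: le_trans uz; apply: ereal_inf_lbound; exists u.
- exact: Vminimizer_exists.
move=> u [ubox umin]; set g := gamma P a b v0 x t u.
have ag : admissible P a b x t g by exact: gamma_admissible.
have gopt w : admissible P a b x t w ->
    (cost Phi (P *m P^T) v0 t g <= cost Phi (P *m P^T) v0 t w)%E.
  move=> aw; have [v vbox vw] := cost_ge w aw.
  by rewrite cost_gamma//; apply: le_trans vw; exact: umin.
split=> // cPhi z [az zopt] s hs.
have [fz cz] := admissible_feasible Phi v0 a_gt0 b_gt0 P_unit az.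
have [fg cg] := admissible_feasible Phi v0 a_gt0 b_gt0 P_unit ag.
set W := (fun s => P^T *m (z s - v0)) in fz cz.
set G := (fun s => P^T *m (g s - v0)) in fg cg.
have zg : reduced_cost Phi P v0 t W <= reduced_cost Phi P v0 t G.
  by rewrite -lee_fin -cz -cg; exact: zopt.
have mid : reduced_cost Phi P v0 t G <=
    reduced_cost Phi P v0 t (fun s => 2^-1 *: (W s + G s)).
  have [v vbox] := feasible_ge _ (feasible_midpoint fz fg).
  rewrite -lee_fin -cg cost_gamma//; apply: le_trans; exact: umin.
have := reduced_cost_midpoint P v0 a_gt0 b_gt0 cPhi fz fg.
set S := \sum_i _ => hS; have S0 : S <= 0 by lra.
have WG i r : 0 <= r <= t -> W r i 0 = G r i 0.
  move=> hr; apply/eqP; rewrite -subr_eq0; apply/eqP; move: r hr.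
  apply: (@slope_bounded_energy_eq0 _ (a i 0 + b i 0) (a i 0 + b i 0)) => //.
  - by rewrite ltW// addr_gt0.
  - by rewrite ltW// addr_gt0.
  - move=> p q p0 pq qt.
    have := proj2 fz i p q p0 pq qt; have := proj2 fg i p q p0 pq qt.
    rewrite /=; lra.
  - apply: le_trans S0; rewrite /S (bigD1 i)//= lerDl.
    by apply: sumr_ge0 => j _; exact: energy_ge0.
apply: (can_inj (subrK v0)); apply: (can_inj (mulKmx PT_unit)).
by apply/colP => i; exact: WG.
Qed.
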